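(* Let $\epsilon>0$ and $\delta\in(0,1)$, and set $$T_r=\left\lceil\frac{\log(\delta/2K)}{\log(1-1/4K)}\right\rceil,\qquad T_s=\left\lceil\frac{8N^2}{\epsilon^2}\log\left(\frac{4NK}{\delta}\right)\right\rceil,\qquad T_b=\left\lceil\log_2(4N/\epsilon)\right\rceil .$$ Then, for any mean reward matrix $M$, the DOA policy with inputs $K,T_s,T_r,T_b$ is $(\epsilon,\delta)$-optimal after $T_r+KT_s+NKT_b$ rounds; that is, for every round $t>T_r+KT_s+NKT_b$, the arms $\alpha^n_t$ selected by the players satisfy $$\Pr\left\{\sum_{n\in[N]}\mu_{n,\alpha^n_t}\ge\sum_{n\in[N]}\mu_{n,\pi^*(n)}-\epsilon\right\}\ge 1-\delta .$$
   Context: Problem. There are $N$ players and $K$ arms, $1\le N\le K$; $[m]=\{1,\dots,m\}$; $\log$ is the natural logarithm and $\log_2$ the logarithm to base 2. For each player $n$ and arm $k$ there is an i.i.d. (over rounds $t$) reward process $S^n_k(t)$ with values in $[0,1]$ and mean $\mu_{n,k}$, independent across arms; $M=\{\mu_{n,k}\}$ is the mean reward matrix. In each round every player selects one arm and either plays it or observes it. A player who plays an arm that nobody else plays receives $S^n_k(t)$; if two or more players play the same arm they collide (and notice it) and each receives $0$. A player who observes an arm receives $0$ and learns only whether at least one other player is playing it. Players have no other communication; each player's decisions depend only on her own past observations (and private randomness). $\Pi$ is the set of injective maps $\pi:[N]\to[K]$ and $\pi^*\in\arg\max_{\pi\in\Pi}\sum_n\mu_{n,\pi(n)}$. A policy is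 a collection of decision rules, one per player; $\alpha^n_t$ denotes the arm selected by player $n$ in round $t$. DOA policy (run separately by every player; inputs $K,T_s,T_r,T_b$). (1) Random Hopping. For $T_r$ rounds each player plays an arm chosen uniformly at random from $[K]$, independently in each round, until she has a collision-free round; from then on she keeps playing that same arm. Let $k$ be her final arm. Then there are $K$ further rounds: in the $j$-th of these, a player whose arm is $k=j$ plays arm $j$ and all other players observe arm $j$. Each player sets $A$ to be the set of arms $i\ne k$ on which she observed a play, $N:=|A|+1$, and her index $n:=|\{j\in A:j<k\}|+1$. (2) Sequential Hopping. For $KT_s$ rounds each player plays the arms cyclically (after arm $k$ she plays the next arm modulo $K$), so each arm is played $T_s$ times by her; she sets $\hat\mu_{n,k}$ equal to (total reward obtained from arm $k$ in this phase)$/T_s$. (3) Packetized Signaling. This consists of $NK$ frames of $T_b$ rounds each, ordered by player index $i=1,\dots,N$ and then arm $j=1,\dots,K$. In frame $(i,j)$ player $i$ signals on arm $j$ the $T_b$-bit binary encoding (truncation, with error at most $2^{-T_b}$) of $\hat\mu_{i,j}$, playing arm $j$ for bit 1 and not playing for bit 0, while all other players observe arm $j$ and decode. At the end all players, including the signaling one, use the decoded (truncated) values as entries of the common $N\times K$ matrix $\hat M$. (4) Each player computes an assignment $\hat\pi^*\in\arg\max_{\pi\in\Pi}\sum_n\hat M_{n,\pi(n)}$ by the same deterministic algorithm with the same deterministic tie-breaking rule, and the player with index $n$ plays arm $\hat\pi^*(n)$ in all later rounds.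
   Formalization: The guarantee is proved for rounds t > T_r + K + KT_s + NKT_b: the K identification rounds after random hopping, omitted from the stated count, are added, since with the stated count the claim fails while the players are still signaling. *)

(* Defs.v *)
From HB Require Import structures.
From mathcomp Require Import all_boot all_order all_algebra.
From mathcomp Require Import all_classical all_reals all_analysis.
Set Implicit Arguments.
Unset Strict Implicit.
Unset Printing Implicit Defensive.
Import Order.TTheory GRing.Theory Num.Theory.
Import numFieldNormedType.Exports.
Local Open Scope classical_set_scope.
Local Open Scope ring_scope.

(* Arms and players are ordinals, hence numbered from 0. Rounds are numbered
   from 0 too: exactly t rounds precede round t, so the rounds coming after
   the first T0 ones are those with T0 <= t. *)

(* An action is the selected arm, with [true] for playing and [false] for
   observing it. *)
Definition action (K : nat) : Type := ('I_K * bool)%type.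
Definition play (K : nat) (k : 'I_K) : action K := (k, true).
Definition observe (K : nat) (k : 'I_K) : action K := (k, false).

(* [someone_else a n]: another player plays the arm selected by n. This is a
   collision when n plays, and what n learns when n observes. *)
Definition someone_else (N K : nat) (a : 'I_N -> action K) (n : 'I_N) : bool :=
  [exists m : 'I_N, (m != n) && (a m == play (a n).1)].

Definition payoff (R : realType) (N K : nat) (s : 'I_N -> 'I_K -> R)
    (a : 'I_N -> action K) (n : 'I_N) : R :=
  if (a n).2 && ~~ someone_else a n then s n (a n).1 else 0.

(* What a player knows of one past round. *)
Record observation (R : realType) (K : nat) := Observation {
  obs_action : action K;
  obs_reward : R;
  obs_busy : bool }.

Definition obs_arm (R : realType) (K : nat) (o : observation R K) : 'I_K :=
  (obs_action o).1.

(* A decision rule maps the private random draws of a player (one arm per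
   round) and her own past observations to her next action. *)
Definition decision_rule (R : realType) (K : nat) : Type :=
  (nat -> 'I_K) -> seq (observation R K) -> action K.

(* Observations of each player over the first t rounds, under the policy
   [rule], for the draws u and the rewards s (round, player, arm). *)
Fixpoint history (R : realType) (N K : nat) (rule : 'I_N -> decision_rule R K)
    (u : 'I_N -> nat -> 'I_K) (s : nat -> 'I_N -> 'I_K -> R) (t : nat) :
    'I_N -> seq (observation R K) :=
  if t is t'.+1 then
    let h := history rule u s t' in
    let a := fun n => rule n (u n) (h n) in
    fun n => rcons (h n)
      (Observation (a n) (payoff (s t') a n) (someone_else a n))
  else fun=> [::].

(* The arm alpha^n_t. *)
Definition selected_arm (R : realType) (N K : nat)
    (rule : 'I_N -> decision_rule R K)
    (u : 'I_N -> nat -> 'I_K) (s : nat -> 'I_N -> 'I_K -> R)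
    (t : nat) (n : 'I_N) : 'I_K :=
  (rule n (u n) (history rule u s t n)).1.

Definition optimal_assignment (R : realType) (N K : nat) (M : 'M[R]_(N, K))
    (pi : 'I_N -> 'I_K) : Prop :=
  injective pi /\
  forall pi' : 'I_N -> 'I_K, injective pi' ->
    \sum_n M n (pi' n) <= \sum_n M n (pi n).

Section DOA.
Context (R : realType) (K Ts Tr Tb : nat).
(* The deterministic assignment algorithm shared by the players. *)
Context (assign : forall N : nat, 'M[R]_(N, K) -> 'I_N -> 'I_K).

Section OnePlayer.
Context (u : nat -> 'I_K) (h : seq (observation R K)).

(* Arm of the first collision-free round among the first Tr ones if there is
   one, and else the arm k drawn for round t. *)
Definition hop_arm (t : nat) : 'I_K :=
  head (u t) [seq obs_arm o | o <- take Tr h & ~~ obs_busy o].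

Definition final_arm : 'I_K := hop_arm Tr.-1.

Definition past (t : nat) : observation R K :=
  nth (Observation (observe final_arm) 0 false) h t.

(* i as an arm; the default value is irrelevant, since it is used for i < K. *)
Definition to_arm (i : nat) : 'I_K := insubd final_arm i.

Definition others : {set 'I_K} :=
  [set i : 'I_K | (i != final_arm) && obs_busy (past (Tr + i))].

Definition nplayers : nat := #|others|.+1.

(* [inord] is not a truncation here: the cardinal is at most #|others|. *)
Definition own_index : 'I_nplayers :=
  inord #|[set j in others | (j < final_arm)%N]|.

Definition seq_start : nat := (Tr + K)%N.
Definition sig_start : nat := (seq_start + K * Ts)%N.
Definition sig_end : nat := (sig_start + nplayers * K * Tb)%N.

Definition mean_estimate (j : 'I_K) : R :=
  (\sum_(i < K * Ts | obs_arm (past (seq_start + i)) == j)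
     obs_reward (past (seq_start + i))) / Ts%:R.

(* Bits of the largest c / 2 ^ Tb <= x with c < 2 ^ Tb, most significant first;
   for x = 1 this is 1 - 2 ^ - Tb. *)
Definition signal_bit (x : R) (b : nat) : bool :=
  odd (minn (Num.truncn (x * 2 ^+ Tb)) (2 ^ Tb).-1 %/ 2 ^ (Tb - b.+1)).

Definition decode_bits (c : nat -> bool) : R :=
  \sum_(b < Tb) (c b)%:R / 2 ^+ b.+1.

Definition decoded_means : 'M[R]_(nplayers, K) :=
  \matrix_(i, j) decode_bits (fun b =>
    if i == own_index then signal_bit (mean_estimate j) b
    else obs_busy (past (sig_start + (i * K + j) * Tb + b))).

Definition doa_action : action K :=
  let t := size h in
  if (t < Tr)%N then play (hop_arm t)
  else if (t < seq_start)%N then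
    let j := to_arm (t - Tr) in
    if j == final_arm then play j else observe j
  else if (t < sig_start)%N then
    play (to_arm ((final_arm + (t - seq_start)) %% K))
  else if (t < sig_end)%N then
    let frame := ((t - sig_start) %/ Tb)%N in
    let b := ((t - sig_start) %% Tb)%N in
    let i := (frame %/ K)%N in
    let j := to_arm (frame %% K) in
    if (i == own_index) && signal_bit (mean_estimate j) b then play j else observe j
  else play (assign decoded_means own_index).

End OnePlayer.

Definition doa : decision_rule R K := doa_action.

End DOA.

Section Probability.
Context (d : measure_display) (T : measurableType d) (R : realType).
Context (P : probability T R).

Definition mutually_independent (I : eqType) (F : I -> set (set T)) : Prop :=
  forall (J : seq I) (E : I -> set T), uniq J -> (forall i, F i (E i)) ->
    P (\big[setI/setT]_(i <- J) E i) = (\prod_(i <- J) P (E i))%E.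

Definition events_of (X : T -> R) : set (set T) :=
  preimage_set_system [set: T] X measurable.

(* S n k t is the reward of player n on arm k in round t. The rewards of
   different players may be dependent. *)
Definition reward_process (N K : nat) (S : 'I_N -> 'I_K -> nat -> {RV P >-> R})
    (mu : 'M[R]_(N, K)) : Prop :=
  [/\ forall n k t w, 0 <= S n k t w <= 1,
      forall n k t, ('E_P[S n k t] = (mu n k)%:E)%E,
      forall n k t t' (B : set R), measurable B ->
        distribution P (S n k t) B = distribution P (S n k t') B
    & forall n, mutually_independent
        (fun i : 'I_K * nat => events_of (S n i.1 i.2))].

(* The draws U n t (player n, round t) are uniform, and they are independent
   of each other and of the whole family of rewards: [None] indexes the
   sigma-algebra generated by the rewards. *)
Definition private_draws (N K : nat) (S : 'I_N -> 'I_K -> nat -> {RV P >-> R})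
    (U : 'I_N -> nat -> T -> 'I_K) : Prop :=
  [/\ forall n t k, measurable [set w | U n t w = k],
      forall n t k, P [set w | U n t w = k] = (K%:R^-1)%:E
    & mutually_independent (fun i : option ('I_N * nat) =>
        if i is Some (n, t) then [set U n t @^-1` B | B in [set: set 'I_K]]
        else <<s \bigcup_(j in [set: 'I_N * 'I_K * nat])
                   events_of (S j.1.1 j.1.2 j.2) >>)].

(* (eps, delta)-optimality after T0 rounds of the selected arms alpha. *)
Definition eps_delta_optimal (N K : nat) (mu : 'M[R]_(N, K))
    (alpha : T -> nat -> 'I_N -> 'I_K) (eps delta : R) (T0 : nat) : Prop :=
  forall t : nat, (T0 <= t)%N ->
  forall pistar : 'I_N -> 'I_K, optimal_assignment mu pistar ->
    ((1 - delta)%:E <=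
     P [set w | (\sum_n mu n (pistar n) - eps <=
                   \sum_n mu n (alpha w t n))%R])%E.

End Probability.

(* Numbers of rounds, so negative values are replaced by 0. *)
Definition nat_ceil (R : realType) (x : R) : nat := absz (Num.max 0%R (Num.ceil x)).

Definition log2 (R : realType) (x : R) : R := ln x / ln 2.

Definition hopping_rounds (R : realType) (K : nat) (delta : R) : nat :=
  nat_ceil (ln (delta / (2 * K%:R)) / ln (1 - 1 / (4 * K%:R))).

Definition samples_per_arm (R : realType) (N K : nat) (eps delta : R) : nat :=
  nat_ceil (8 * N%:R ^+ 2 / eps ^+ 2 * ln (4 * N%:R * K%:R / delta)).

Definition packet_length (R : realType) (N : nat) (eps : R) : nat :=
  nat_ceil (log2 (4 * N%:R / eps)).

(* Main.v *)
Require Import Defs.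
From mathcomp Require Import all_boot all_order all_algebra.
From mathcomp Require Import all_classical all_reals all_analysis.
From mathcomp Require Import measurable_realfun ring lra.
Import Order.TTheory GRing.Theory Num.Theory.
Import numFieldNormedType.Exports.
Local Open Scope classical_set_scope.
Local Open Scope ring_scope.

(* Hopping. In each round the other players occupy at most N - 1 < K arms,
   whatever they do, so an unsettled player draws a free arm with probability at
   least 1 / K >= 1 / (4 K); counting draw vectors round by round and a union
   bound over the players bound the probability that somebody is unsettled after
   Tr rounds by delta / 2.

   Estimation. Once all players are settled, on pairwise distinct arms, the rest
   of the run is deterministic up to the rewards: the sequential phase has no
   collision and gives player n, for arm j, the average of Ts rewards at times
   depending only on her final arm, hence on the draws, of which the rewards are
   independent. Hoeffding's inequality and a union bound over (n, j) bound by
   delta / 2 the probability that some average is off by more than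
   eps / (4 N).

   Optimality. Truncation costs another 2 ^ - Tb <= eps / (4 N), so the common
   matrix is within eps / (2 N) of the permuted mean matrix, entrywise, and its
   optimal assignment loses at most eps.

   The independence hypothesis speaks of events only, so Hoeffding's inequality
   is proved without integrating products: [0, 1]^n is cut into the cells of a
   grid, the probabilities of the cells factor, and the mesh tends to 0.

   The event of the theorem has to be measurable: the players' actions range
   over a countable set, and on each of its elements the next actions depend on
   the rewards through finitely many truncated sample means. *)

Set Implicit Arguments.
Unset Strict Implicit.
Unset Printing Implicit Defensive.

(** * Hoeffding's inequality *)

Lemma ger0_is_derive_le (R : realType) (f g : R -> R) (s : R) : 0 <= s ->
  (forall x : R, is_derive x (1 : R) f (g x)) -> (forall x, 0 <= x -> 0 <= g x) ->
  f 0 <= f s.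
Proof.
move=> s0 fg g0.
have fd (x : R) : derivable f x 1 by apply: ex_derive.
apply: (@ger0_derive1_le_cc _ f 0 s) => //.
- move=> x; rewrite in_itv /= => /andP[x0 _].
  by rewrite derive1E derive_val g0 // ltW.
- by apply: derivable_within_continuous => x _.
- by rewrite in_itv /= lexx.
- by rewrite in_itv /= s0 lexx.
Qed.

(* With [q x = p e^x / (1 - p + p e^x)], the logarithm of the quotient of the
   two sides has derivative [p + x / 4 - q x] and second derivative
   [1 / 4 - q x (1 - q x) >= 0]. *)
Lemma bernoulli_mgf_le (R : realType) (p s : R) : 0 <= p <= 1 -> 0 <= s ->
  1 - p + p * expR s <= expR (s * p + s ^+ 2 / 8).
Proof.
move=> /andP[p0 p1] s0; pose D (x : R) := 1 - p + p * expR x.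
have D0 x : 0 < D x.
  have e0 := expR_gt0 x; rewrite /D.
  have [->|pn0] := eqVneq p 0; first by rewrite mul0r subr0 addr0.
  have pp : 0 < p by rewrite lt_neqAle eq_sym pn0.
  by apply: ltr_wpDl; rewrite ?subr_ge0 ?mulr_gt0.
have dD x : is_derive x (1:R) D (p * expR x).
  by apply: is_derive_eq; rewrite add0r mul1r.
(* [q] names the whole first derivative: [(1 - p) / D x] is one minus the quotient [p e^x / D x]. *)
pose q (x : R) := p + x / 4 - 1 + (1 - p) * (D x)^-1.
have dq x : is_derive x (1:R) q (1 / 4 - (1 - p) * (p * expR x) / D x ^+ 2).
  have Dx : D x != 0 by rewrite gt_eqF.
  apply: is_derive_eq; rewrite /GRing.scale /=.
  by field.
have q0 x : 0 <= x -> 0 <= q x.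
  move=> x0; have <- : q 0 = 0.
    by rewrite /q /D expR0; field; rewrite ?mulr1 ?subrK ?oner_neq0.
  apply: (ger0_is_derive_le x0 dq) => y _.
  rewrite subr_ge0 ler_pdivrMr ?exprn_gt0 // /D.
  (* [4 a b <= (a + b) ^ 2] with [a = 1 - p] and [b = p e^y], whose sum is [D y]. *)
  by have := sqr_ge0 (1 - p - p * expR y); nra.
pose L (x : R) := p * x + x ^+ 2 / 8 - ln (D x).
have dL x : is_derive x (1:R) L (q x).
  have dln := is_derive1_ln (D0 x).
  have Dx : D x != 0 by rewrite gt_eqF.
  have dlnD : is_derive x (1:R) (@ln R \o D) ((D x)^-1 * (p * expR x)).
    by apply: is_derive_eq; rewrite /GRing.scale /=.
  apply: is_derive_eq; rewrite /GRing.scale /= /q.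
  by rewrite /D in Dx *; field.
have := ger0_is_derive_le s0 dL q0.
rewrite {1}/L {1}/D expR0 !mulr1 subrK ln1 mulr0 expr0n mul0r subr0 add0r /L.
rewrite subr_ge0 => h; rewrite -/(D s) -[D s]lnK ?posrE // ler_expR.
by rewrite (mulrC s p).
Qed.

(** * Step functions and bounds on probabilities *)

Section StepFunctions.
Context (d : measure_display) (T : measurableType d) (R : realType).
Context (P : probability T R).

Lemma fineP (A : set T) : measurable A -> P A = (fine (P A))%:E.
Proof. by move=> mA; rewrite fineK // fin_num_measure. Qed.

Lemma integral_step (I : finType) (a : I -> R) (C : I -> set T) :
  (forall i, 0 <= a i) -> (forall i, measurable (C i)) ->
  (\int[P]_w (\sum_i a i * \1_(C i) w)%:E = (\sum_i a i * fine (P (C i)))%:E)%E.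
Proof.
move=> a0 mC; under eq_integral do rewrite -sumEFin.
have m1 i : measurable_fun setT (fun w => (\1_(C i) w)%:E).
  by apply/measurable_EFinP; apply: measurable_indic.
rewrite ge0_integral_sum //.
- rewrite -sumEFin; apply: eq_bigr => i _.
  under eq_integral do rewrite EFinM.
  rewrite ge0_integralZl_EFin //.
  by rewrite integral_indic // setIT EFinM -fineP.
- by move=> i; apply/measurable_EFinP; apply: measurable_funM.
- by move=> i w _; rewrite lee_fin mulr_ge0.
Qed.

Lemma step_measurable (I : finType) (a : I -> R) (C : I -> set T) :
  (forall i, measurable (C i)) ->
  measurable_fun setT (fun w => (\sum_i a i * \1_(C i) w)%:E).
Proof.
move=> mC; apply/measurable_EFinP.
apply: measurable_sum => i; by apply: measurable_funM => //; apply: measurable_indic.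
Qed.

(** The step function dominates the indicator of [A]. Coefficients 1 give the union bound,
    exponential weights on grid cells give the exponential Markov inequality. *)
Lemma fine_prob_le_sum (I : finType) (a : I -> R) (C : I -> set T) (A : set T) :
  (forall i, 0 <= a i) -> (forall i, measurable (C i)) -> measurable A ->
  (forall w, A w -> exists2 i, C i w & 1 <= a i) ->
  fine (P A) <= \sum_i a i * fine (P (C i)).
Proof.
move=> a0 mC mA AC; rewrite -lee_fin -fineP // -integral_step //.
rewrite -[X in P X]setIT -integral_indic //.
apply: ge0_le_integral => //.
- by apply/measurable_EFinP; apply: measurable_indic.
- exact: step_measurable.
move=> w _; rewrite lee_fin; have s0 : 0 <= \sum_i a i * \1_(C i) w.
  by apply: sumr_ge0 => i _; rewrite mulr_ge0.
rewrite indicE; case: (boolP (w \in A)) => // /set_mem /AC [i Ci ai].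
rewrite (bigD1 i) //= indicE mem_set // mulr1 (le_trans ai) // lerDl.
by apply: sumr_ge0 => j _; rewrite mulr_ge0.
Qed.

Lemma fine_prob_le_union (I : finType) (C : I -> set T) (A : set T) :
  (forall i, measurable (C i)) -> measurable A ->
  (forall w, A w -> exists i, C i w) ->
  fine (P A) <= \sum_i fine (P (C i)).
Proof.
move=> mC mA AC; under [leRHS]eq_bigr do rewrite -[fine _]mul1r.
by apply: fine_prob_le_sum => // w /AC [i Ci]; exists i.
Qed.

Lemma fine_prob_ge0 (A : set T) : 0 <= fine (P A).
Proof. by rewrite fine_ge0. Qed.

End StepFunctions.

Section Cells.
Context (R : realType).

(** For [c > 0] this is the interval [k / c, (k + 1) / c[, joined for [k = 0] by the negative reals.
    These are the cells of the grid and, for [c = 2 ^ Tb], sets on which the signalled bits are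
    constant. *)
Definition truncn_cell (c : R) (k : nat) : set R := [set x | Num.truncn (x * c) = k].

Lemma measurable_truncn_cell (c : R) (k : nat) : measurable (truncn_cell c k).
Proof.
have mge j : measurable [set x : R | (j < Num.truncn (x * c))%N].
  have -> : [set x : R | (j < Num.truncn (x * c))%N] =
      ( *%R^~ c) @^-1` [set` `[j.+1%:R, +oo[%R].
    by apply/seteqP; split=> x /=; rewrite in_itv /= truncn_gt_nat andbT.
  by rewrite -[X in measurable X]setTI; apply: mulrr_measurable.
have -> : truncn_cell c k =
    (if k is k'.+1 then [set x : R | (k' < Num.truncn (x * c))%N] else setT) `\`
    [set x : R | (k < Num.truncn (x * c))%N].
  apply/seteqP; split=> x; rewrite /truncn_cell /=.
    by case: k => [|k] e; split; rewrite /= ?e ?ltnn.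
  case: k => [|k] /= [h1 /negP]; rewrite -leqNgt; first by rewrite leqn0 => /eqP.
  by move=> h2; apply/eqP; rewrite eqn_leq h2 h1.
by apply: measurableD => //; case: k.
Qed.

End Cells.

(** Convexity bounds the exponential by its chord, which is affine in [x], so that only the mean
    matters after integration. *)
Lemma expR_chord (R : realType) (s x : R) : 0 <= x <= 1 ->
  expR (s * x) <= 1 + (expR s - 1) * x.
Proof.
move=> /andP[x0 x1]; 
have h : expR (x * s + (1 - x) * 0) <= x * expR s + (1 - x) * expR 0 :=
  convex_expR (Itv01 x0 x1) s 0.
rewrite mulrC; move: h; rewrite mulr0 addr0 expR0 mulr1 => h.
by apply: le_trans h _; lra.
Qed.

Lemma in_bigsetI (I : eqType) (T : Type) (r : seq I) (F : I -> set T) w :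
  (\big[setI/setT]_(i <- r) F i) w <-> (forall i, i \in r -> F i w).
Proof.
elim: r => [|j r ih]; first by rewrite big_nil; split.
rewrite big_cons; split=> [[Fj /ih h] i|h].
  by rewrite inE => /predU1P[->|/h].
split; first by apply: h; rewrite mem_head.
by apply/ih => i ir; apply: h; rewrite inE ir orbT.
Qed.

(** * The Chernoff bound on a grid and its limit *)

Section Hoeffding.
Context (d : measure_display) (T : measurableType d) (R : realType).
Context (P : probability T R) (n : nat) (X : 'I_n -> T -> R) (p : R).
Hypothesis mX : forall i, measurable_fun setT (X i).
Hypothesis X01 : forall i w, 0 <= X i w <= 1.
Hypothesis EX : forall i, (\int[P]_w (X i w)%:E = p%:E)%E.
Hypothesis indep : forall B : 'I_n -> set R, (forall i, measurable (B i)) ->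
  P (\big[setI/setT]_i (X i @^-1` B i)) = (\prod_i P (X i @^-1` B i))%E.

Let measurable_pre i (B : set R) : measurable B -> measurable (X i @^-1` B).
Proof. by move=> mB; rewrite -[X in measurable X]setTI; apply: mX. Qed.

(** There are [m.+1] cells because the value 1 has truncation [m]. *)
Let X_cell m i w : (0 < m)%N -> exists2 k : 'I_m.+1,
  truncn_cell m%:R k (X i w) & k%:R / m%:R <= X i w <= k.+1%:R / m%:R.
Proof.
move=> m0; have /andP[x0 x1] := X01 i w.
have m0' : 0 < m%:R :> R by rewrite ltr0n.
have y0 : 0 <= X i w * m%:R by rewrite mulr_ge0 // ltW.
have km : (Num.truncn (X i w * m%:R) < m.+1)%N.
  rewrite ltnS -[leqRHS](@natrK R); apply: le_truncn.
  by rewrite ler_piMl // ltW.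
exists (Ordinal km) => //=.
have /andP[h1 h2] := truncn_itv y0.
by rewrite ler_pdivrMr // h1 /= ler_pdivlMr // ltW.
Qed.

(** The left side is the mean of [X i] rounded down to the grid. *)
Let mean_cells m i : (0 < m)%N ->
  \sum_(k < m.+1) k%:R / m%:R * fine (P (X i @^-1` truncn_cell m%:R k)) <= p.
Proof.
move=> m0; have mC (k : 'I_m.+1) : measurable (X i @^-1` truncn_cell m%:R k).
  by apply: measurable_pre; apply: measurable_truncn_cell.
have a0 (k : 'I_m.+1) : 0 <= k%:R / m%:R :> R by rewrite divr_ge0.
rewrite -lee_fin -(integral_step P a0 mC) -(EX i).
apply: ge0_le_integral => //.
- by move=> w _; rewrite lee_fin sumr_ge0 // => k _; rewrite mulr_ge0.
- exact: step_measurable.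
- by apply/measurable_EFinP.
move=> w _; rewrite lee_fin; have [k kc /andP[kX _]] := X_cell i w m0.
rewrite (bigD1 k) //= big1 ?addr0 => [|j jk].
  by rewrite indicE mem_set // mulr1.
rewrite indicE memNset ?mulr0 //=; rewrite /truncn_cell /= kc => /val_inj kj.
by rewrite kj eqxx in jk.
Qed.

Let sum_cells m i : (0 < m)%N ->
  \sum_(k < m.+1) fine (P (X i @^-1` truncn_cell m%:R k)) = 1.
Proof.
move=> m0; have mC (k : 'I_m.+1) : measurable (X i @^-1` truncn_cell m%:R k).
  by apply: measurable_pre; apply: measurable_truncn_cell.
under eq_bigr do rewrite -[fine _]mul1r.
apply: EFin_inj; rewrite -(integral_step P _ mC) //.
have <- : (\int[P]_w (cst 1 w) = 1)%E.
  by rewrite integral_cst // mul1e; apply: probability_setT.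
apply: eq_integral => w _; have [k kc _] := X_cell i w m0.
congr EFin; rewrite (bigD1 k) //= big1 ?addr0 => [|j jk].
  by rewrite indicE mem_set // mulr1.
rewrite indicE memNset ?mulr0 //=; rewrite /truncn_cell /= kc => /val_inj kj.
by rewrite kj eqxx in jk.
Qed.

Let fine_indep (B : 'I_n -> set R) : (forall i, measurable (B i)) ->
  fine (P (\big[setI/setT]_i (X i @^-1` B i))) = \prod_i fine (P (X i @^-1` B i)).
Proof.
move=> mB; rewrite indep //.
rewrite (eq_bigr (fun i => (fine (P (X i @^-1` B i)))%:E)) => [|i _]; last first.
  by rewrite -fineP //; apply: measurable_pre.
by rewrite -(big_morph EFin (@EFinM R) erefl).
Qed.

(** On the tail, [e^(s (sum - a)) >= 1]. On a cell of the grid this exponential is at most the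
    product of the chords [b] taken at the upper ends. The cell probabilities factor, the sum over
    cells becomes a product of sums, and each factor is one plus [c] times the mean rounded up,
    which is at most [p + 1 / m]. *)
Let tail_le_grid (m : nat) (s a : R) : (0 < m)%N -> 0 <= s ->
  fine (P [set w | a <= \sum_i X i w]) <=
  expR (- (s * a)) * (1 + (expR s - 1) * (p + m%:R^-1)) ^+ n.
Proof.
move=> m0 s0; set c := expR s - 1.
have c0 : 0 <= c by rewrite subr_ge0 -expR0 ler_expR.
have m0' : 0 < m%:R :> R by rewrite ltr0n.
pose b (k : 'I_m.+1) : R := 1 + c * (k.+1%:R / m%:R).
pose F i (k : 'I_m.+1) : R := b k * fine (P (X i @^-1` truncn_cell m%:R k)).
pose cell (phi : {ffun 'I_n -> 'I_m.+1}) :=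
  \big[setI/setT]_i (X i @^-1` truncn_cell m%:R (phi i)).
have b0 k : 0 <= b k by rewrite addr_ge0 // mulr_ge0 // divr_ge0.
have mcell (k : 'I_m.+1) : measurable (truncn_cell m%:R k : set R).
  exact: measurable_truncn_cell.
have tail_le : fine (P [set w | a <= \sum_i X i w]) <=
    \sum_(phi : {ffun 'I_n -> 'I_m.+1})
      (expR (- (s * a)) * \prod_i b (phi i)) * fine (P (cell phi)).
  apply: fine_prob_le_sum.
  - by move=> phi; rewrite mulr_ge0 ?expR_ge0 // prodr_ge0.
  - move=> phi; apply: bigsetI_measurable => i _; exact: measurable_pre.
  - rewrite -[X in measurable X]setTI.
    have -> : [set w | a <= \sum_i X i w] =
        (fun w => \sum_i X i w) @^-1` [set` `[a, +oo[%R].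
      by apply/seteqP; split=> w /=; rewrite in_itv /= andbT.
    by apply: measurable_sum => //.
  move=> w /= aX.
  have hk i : exists k : 'I_m.+1,
      truncn_cell m%:R k (X i w) /\ X i w <= k.+1%:R / m%:R.
    by have [k kc /andP[_ kX]] := X_cell i w m0; exists k.
  have [phi hphi] := choice hk.
  exists [ffun i => phi i].
    by apply/in_bigsetI => i _; rewrite ffunE; case: (hphi i).
  rewrite -[leLHS](mulVf (lt0r_neq0 (expR_gt0 (s * a)))) -expRN.
  rewrite ler_wpM2l ?expR_ge0 //.
  apply: (@le_trans _ _ (expR (\sum_i s * X i w))).
    by rewrite ler_expR -mulr_sumr ler_wpM2l.
  rewrite expR_sum; apply: ler_prod => i _; rewrite expR_ge0 ffunE /=.
  apply: le_trans (expR_chord s (X01 i w)) _.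
  by rewrite lerD2l ler_wpM2l //; case: (hphi i).
apply: le_trans tail_le _.
under eq_bigr => phi _ do rewrite -mulrA.
rewrite -mulr_sumr ler_wpM2l ?expR_ge0 //.
have -> : \sum_(phi : {ffun 'I_n -> 'I_m.+1}) (\prod_i b (phi i)) * fine (P (cell phi)) =
    \sum_(phi : {ffun 'I_n -> 'I_m.+1}) \prod_i F i (phi i).
  by apply: eq_bigr => phi _; rewrite /cell fine_indep // -big_split.
rewrite -(bigA_distr_bigA F) -[n in leRHS]card_ord -prodr_const.
apply: ler_prod => i _; rewrite sumr_ge0 /=; last first.
  by move=> k _; rewrite mulr_ge0 // fine_prob_ge0.
have -> : \sum_k F i k = (1 + c / m%:R) *
      \sum_(k < m.+1) fine (P (X i @^-1` truncn_cell m%:R k)) +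
    c * \sum_(k < m.+1) k%:R / m%:R * fine (P (X i @^-1` truncn_cell m%:R k)).
  rewrite !mulr_sumr -big_split /=; apply: eq_bigr => k _.
  by rewrite /F /b -natr1; ring.
rewrite sum_cells // mulr1 mulrDr addrA [leRHS]addrAC lerD2l.
by rewrite ler_wpM2l // mean_cells.
Qed.

Lemma hoeffding_upper (tau : R) : 0 <= p <= 1 -> 0 <= tau ->
  fine (P [set w | n%:R * (p + tau) <= \sum_i X i w]) <=
  expR (- (2 * n%:R * tau ^+ 2)).
Proof.
move=> p01 tau0; apply/ler_addgt0Pr => e e0.
(* This [s] minimises [s ^ 2 / 8 - s tau], with minimum [- 2 tau ^ 2]. *)
pose s := 4 * tau; set q := fine _.
have s0 : 0 <= s by rewrite /s mulr_ge0.
set c := expR s - 1.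
have c0 : 0 <= c by rewrite subr_ge0 -expR0 ler_expR.
pose g m : R := expR (- (2 * n%:R * tau ^+ 2)) * expR (n%:R * c / m%:R).
have qg m : (0 < m)%N -> q <= g m.
  move=> m0; have m0' : 0 < m%:R :> R by rewrite ltr0n.
  apply: le_trans (tail_le_grid _ m0 s0) _; rewrite -/c.
  have h : 1 + c * (p + m%:R^-1) <= expR (s * p + s ^+ 2 / 8 + c / m%:R).
    rewrite expRD; have := bernoulli_mgf_le p01 s0.
    set E := expR (s * p + s ^+ 2 / 8) => hE.
    (* The term [c / m] stands outside [E]; since [1 <= E], it may be replaced by [E c / m]. *)
    have E1 : 1 <= E.
      by rewrite /E -expR0 ler_expR addr_ge0 // mulr_ge0 ?exprn_ge0 //; case/andP: p01.
    have cm : 0 <= c / m%:R by rewrite divr_ge0 // ltW.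
    apply: (@le_trans _ _ (E * (1 + c / m%:R))).
      rewrite mulrDr addrA [leRHS]mulrDr mulr1 lerD //; last by rewrite ler_peMl.
      by apply: le_trans hE; rewrite /c; lra.
    by rewrite ler_wpM2l ?expR_ge1Dx // ltW // (lt_le_trans ltr01).
  apply: (@le_trans _ _ (expR (- (s * (n%:R * (p + tau)))) *
      expR (s * p + s ^+ 2 / 8 + c / m%:R) ^+ n)).
    rewrite ler_wpM2l ?expR_ge0 // lerXn2r ?nnegrE ?expR_ge0 //.
    rewrite addr_ge0 // mulr_ge0 // addr_ge0 ?invr_ge0 //; case/andP: p01 => //.
  by rewrite -expRM_natl /g -!expRD ler_expR /s; lra.
have l0 : 0 < ln (1 + e) by rewrite ln_gt0 // ltrDl.
(* Fine enough for the loss factor [e^(n c / m)] to be at most [1 + e]; the main factor is at most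
   1, so the additive loss is at most [e]. *)
pose m := (Num.truncn (n%:R * c / ln (1 + e))).+1.
apply: le_trans (qg m isT) _; rewrite /g.
have : expR (n%:R * c / m%:R) <= 1 + e.
  rewrite -[leRHS]lnK ?posrE ?addr_gt0 // ler_expR ler_pdivrMr ?ltr0n //.
  by rewrite [leRHS]mulrC -ler_pdivrMr //; apply/ltW/truncnS_gt.
have : expR (- (2 * n%:R * tau ^+ 2)) <= 1.
  by rewrite -expR0 ler_expR oppr_le0 mulr_ge0 ?mulr_ge0 ?exprn_ge0.
move: (expR_ge0 (- (2 * n%:R * tau ^+ 2))) (expR_ge0 (n%:R * c / m%:R)).
by move: (expR _) (expR _) => x y; nra.
Qed.

End Hoeffding.

(** The lower tail is the upper tail of the variables [1 - X i], which have mean [1 - p] and inherit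
    the independence. *)
Lemma hoeffding (d : measure_display) (T : measurableType d) (R : realType)
    (P : probability T R) (n : nat) (X : 'I_n -> T -> R) (p tau : R) :
  (0 < n)%N -> (forall i, measurable_fun setT (X i)) ->
  (forall i w, 0 <= X i w <= 1) ->
  (forall i, (\int[P]_w (X i w)%:E = p%:E)%E) ->
  (forall B : 'I_n -> set R, (forall i, measurable (B i)) ->
    P (\big[setI/setT]_i (X i @^-1` B i)) = (\prod_i P (X i @^-1` B i))%E) ->
  0 <= tau ->
  fine (P [set w | tau < `|(\sum_i X i w) / n%:R - p|]) <=
  2 * expR (- (2 * n%:R * tau ^+ 2)).
Proof.
move=> n0 mX X01 EX indep tau0; have i0 : 'I_n := Ordinal n0.
have n0' : 0 < n%:R :> R by rewrite ltr0n.
pose Y i w := 1 - X i w.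
have mY i : measurable_fun setT (Y i) by apply: measurable_funB.
have Y01 i w : 0 <= Y i w <= 1 by have := X01 i w; rewrite /Y; lra.
have EY i : (\int[P]_w (Y i w)%:E = (1 - p)%:E)%E.
  have : (\int[P]_w (X i w)%:E + \int[P]_w (Y i w)%:E = 1)%E.
    rewrite -ge0_integralD //; first last.
    - by apply/measurable_EFinP.
    - by move=> w _; rewrite lee_fin; case/andP: (Y01 i w).
    - by apply/measurable_EFinP.
    - by move=> w _; rewrite lee_fin; case/andP: (X01 i w).
    have <- : (\int[P]_w (cst 1 w) = 1)%E.
      by rewrite integral_cst // mul1e; apply: probability_setT.
    by apply: eq_integral => w _; rewrite /Y -EFinD addrC subrK.
  (* The integral of [Y i] is not yet known to be finite; the equation rules out infinite values. *)
  rewrite EX; case: (\int[P]_w _)%E => [r| |] //.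
  by rewrite -EFinD => -[<-]; congr EFin; ring.
have p01 : 0 <= p <= 1.
  apply/andP; split; last rewrite -subr_ge0.
    rewrite -lee_fin -(EX i0); apply: integral_ge0 => w _.
    by rewrite lee_fin; case/andP: (X01 i0 w).
  rewrite -lee_fin -(EY i0); apply: integral_ge0 => w _.
  by rewrite lee_fin; case/andP: (Y01 i0 w).
have indepY (B : 'I_n -> set R) : (forall i, measurable (B i)) ->
    P (\big[setI/setT]_i (Y i @^-1` B i)) = (\prod_i P (Y i @^-1` B i))%E.
  move=> mB; apply: (indep (fun i => (fun x => 1 - x) @^-1` B i)) => i.
  rewrite -[X in measurable X]setTI.
  have mm : measurable_fun setT (fun x : R => 1 - x) by apply: measurable_funB.
  exact: mm.
have mge (Z : 'I_n -> T -> R) a : (forall i, measurable_fun setT (Z i)) ->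
    measurable [set w | a <= \sum_i Z i w].
  move=> mZ; rewrite -[X in measurable X]setTI.
  have -> : [set w | a <= \sum_i Z i w] =
      (fun w => \sum_i Z i w) @^-1` [set` `[a, +oo[%R].
    by apply/seteqP; split=> w /=; rewrite in_itv /= andbT.
  by apply: measurable_sum => //.
have mdev : measurable [set w | tau < `|(\sum_i X i w) / n%:R - p|].
  have md : measurable_fun setT (fun w => `|(\sum_i X i w) / n%:R - p|).
    apply: measurableT_comp => //; apply: measurable_funB => //.
    by apply: measurable_funM => //; apply: measurable_sum.
  rewrite -[X in measurable X]setTI.
  have -> : [set w | tau < `|(\sum_i X i w) / n%:R - p|] =
      (fun w => `|(\sum_i X i w) / n%:R - p|) @^-1` [set` `]tau, +oo[%R].
    by apply/seteqP; split=> w /=; rewrite in_itv /= andbT.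
  exact: md.
pose C (b : bool) := if b then [set w | n%:R * (p + tau) <= \sum_i X i w]
  else [set w | n%:R * (1 - p + tau) <= \sum_i Y i w].
apply: (le_trans (@fine_prob_le_union _ _ _ P _ C _ _ mdev _)).
- by case; apply: mge.
- move=> w /=; rewrite lter_normr => /orP[h|h]; [exists true|exists false]; rewrite /C /=.
    by move: h; rewrite ltrBrDr ltr_pdivlMr // => /ltW; rewrite mulrC (addrC p).
  rewrite /Y sumrB sumr_const card_ord.
  have h' : tau < p - (\sum_i X i w) / n%:R by lra.
  move: h'; rewrite ltrBrDr addrC -ltrBrDr ltr_pdivrMr // => h'.
  by rewrite -subr_ge0; move: h'; lra.
rewrite big_bool /C; set E := expR _; rewrite (_ : 2 * E = E + E); last by ring.
apply: lerD; first exact: hoeffding_upper.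
by apply: hoeffding_upper => //; lra.
Qed.

(** * Random hopping *)

(* [Some k] once the player has settled on arm [k]. *)
Fixpoint hop_state {N K : nat} (u : 'I_N -> nat -> 'I_K) (t : nat) :
    'I_N -> option 'I_K :=
  if t is t'.+1 then
    let arm n := odflt (u n t') (hop_state u t' n) in
    fun n => if hop_state u t' n is Some k then Some k
      else if [exists m : 'I_N, (m != n) && (arm m == arm n)] then None
      else Some (arm n)
  else fun=> None.

Definition hopping_arm {N K : nat} (u : 'I_N -> nat -> 'I_K) (t : nat)
    (n : 'I_N) : 'I_K :=
  odflt (u n t) (hop_state u t n).

Arguments hop_state : simpl never.

Lemma hop_stateS {N K : nat} (u : 'I_N -> nat -> 'I_K) t n :
  hop_state u t.+1 n = if hop_state u t n is Some k then Some k
      else if [exists m : 'I_N, (m != n) && (hopping_arm u t m == hopping_arm u t n)]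
      then None else Some (hopping_arm u t n).
Proof. by []. Qed.

(** The state before round [t] uses earlier draws only, which leaves the draw of round [t] free in
    the counting below. *)
Lemma eq_hop_state {N K : nat} (u v : 'I_N -> nat -> 'I_K) t :
  (forall n i, (i < t)%N -> u n i = v n i) -> hop_state u t =1 hop_state v t.
Proof.
elim: t => // t ih uv n.
have e m : hop_state u t m = hop_state v t m.
  by apply: ih => k i it; apply: uv; apply: ltnW.
have e' m : hopping_arm u t m = hopping_arm v t m.
  by rewrite /hopping_arm e uv.
rewrite !hop_stateS e; case: (hop_state v t n) => //; rewrite e'.
by under eq_existsb do rewrite e'.
Qed.

Lemma hopping_armS {N K : nat} (u : 'I_N -> nat -> 'I_K) t n :
  hop_state u t.+1 n -> hopping_arm u t.+1 n = hopping_arm u t n.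
Proof.
rewrite [in LHS]/hopping_arm hop_stateS.
case e: (hop_state u t n) => [a|]; first by rewrite /hopping_arm e.
by case: ifP.
Qed.

(** A settled player keeps playing her arm, so whoever came to the same arm later would have
    collided; two players arriving together would collide as well. *)
Lemma hopping_arm_inj {N K : nat} (u : 'I_N -> nat -> 'I_K) t n m :
  hop_state u t n -> hop_state u t m -> hopping_arm u t n = hopping_arm u t m ->
  n = m.
Proof.
elim: t n m => // t ih n m hn hm; rewrite !hopping_armS // => e.
apply/eqP/negPn/negP => nm.
have := hn; have := hm; rewrite !hop_stateS.
case em: (hop_state u t m) => [a|]; case en: (hop_state u t n) => [b|].
- by move: nm; rewrite (ih n m) ?eqxx ?em ?en.
- by case: existsP => // h; case: h; exists m; rewrite eq_sym nm e eqxx.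
- by case: existsP => // h; case: h; exists n; rewrite nm e eqxx.
- by case: existsP => // h; case: h; exists n; rewrite nm e eqxx.
Qed.

(** * Counting draw vectors *)

Lemma sum_upd_coord (I : finType) (K : nat) (x : I)
    (A : pred {ffun I -> 'I_K.+1}) :
  (\sum_(v : {ffun I -> 'I_K.+1}) \sum_(k < K.+1)
     A [ffun y => if y == x then k else v y] = K.+1 * #|A|)%N.
Proof.
(* In the cyclic group of arms, replacing coordinate [x] by an arbitrary value amounts to shifting
   it; each fixed shift permutes the vectors. *)
pose sh (k : 'I_K.+1) (v : {ffun I -> 'I_K.+1}) : {ffun I -> 'I_K.+1} :=
  [ffun y => if y == x then (k + v y)%R else v y].
have shI k : injective (sh k).
  move=> v w /ffunP e; apply/ffunP => y; move: (e y); rewrite !ffunE.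
  by case: eqP => // _ /addrI.
transitivity (\sum_(v : {ffun I -> 'I_K.+1}) \sum_(k < K.+1) A (sh k v))%N.
  apply: eq_bigr => v _.
  rewrite (reindex (fun k : 'I_K.+1 => (k + v x)%R)) /=; last first.
    by exists (fun k => (k - v x)%R) => k _; rewrite ?addrK ?subrK.
  apply: eq_bigr => k _; congr (nat_of_bool (A _)); apply/ffunP => y; rewrite !ffunE.
  by case: eqP => // ->.
rewrite exchange_big /=.
transitivity (\sum_(k < K.+1) #|A|)%N; last by rewrite sum_nat_const card_ord.
apply: eq_bigr => k _; rewrite -sum1_card [RHS]big_mkcond /=.
rewrite [RHS](reindex_inj (shI k)) /=; apply: eq_bigr => v _.
by rewrite unfold_in; case: (A _).
Qed.

(** The counting form of a conditional probability: when coordinate [x] of a vector in [A] is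
    redrawn, at most [K] of the [K.+1] values lead into [B], and from outside [A] none does. *)
Lemma card_escape (I : finType) (K : nat) (x : I)
    (A B : pred {ffun I -> 'I_K.+1}) :
  (forall (v : {ffun I -> 'I_K.+1}) k, B [ffun y => if y == x then k else v y] -> A v) ->
  (forall v : {ffun I -> 'I_K.+1}, A v ->
    exists k, ~~ B [ffun y => if y == x then k else v y]) ->
  (K.+1 * #|B| <= K * #|A|)%N.
Proof.
move=> hBA hA; rewrite -(sum_upd_coord x B).
rewrite -sum1_card big_distrr /= [leqRHS]big_mkcond /=; apply: leq_sum => v _.
rewrite unfold_in; case: ifP => Av.
  have [k0 hk0] := hA v Av; rewrite muln1 (bigD1 k0) //= (negbTE hk0) add0n.
  apply: (@leq_trans (\sum_(k < K.+1 | k != k0) 1)%N).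
    by apply: leq_sum => k _; apply: leq_b1.
  by rewrite sum1_card cardC1 card_ord.
rewrite big1 // => k _; case hB: (B _) => //.
by rewrite (hBA _ _ hB) in Av.
Qed.

(* Meaningful for the rounds [t <= T], where [inord] does not truncate. *)
Definition draws_of {N K T : nat} (v : {ffun 'I_N * 'I_T.+1 -> 'I_K}) :
  'I_N -> nat -> 'I_K := fun n t => v (n, inord t).

(* Whatever the other players play, they occupy at most [N - 1 < K] arms. *)
Lemma card_unsettled_succ (N K T t : nat) (n : 'I_N) : (N <= K.+1)%N -> (t <= T)%N ->
  (K.+1 ^ t * #|[pred v : {ffun 'I_N * 'I_T.+1 -> 'I_K.+1} |
                  ~~ hop_state (draws_of v) t n]|
   <= K ^ t * K.+1 ^ (N * T.+1))%N.
Proof.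
move=> NK; elim: t => [_|t ih tT].
  rewrite !mul1n; apply: leq_trans (max_card _) _.
  by rewrite card_ffun card_prod !card_ord.
rewrite !expnS -mulnA mulnCA; move: {ih}(ih (ltnW tT)) => ih.
pose B s := [pred v : {ffun 'I_N * 'I_T.+1 -> 'I_K.+1} |
                  ~~ hop_state (draws_of v) s n].
suff h : (K.+1 * #|B t.+1| <= K * #|B t|)%N.
  apply: leq_trans (leq_mul (leqnn _) h) _.
  by rewrite mulnCA -mulnA leq_mul2l ih orbT.
(* The draw of player [n] in round [t]; redrawing it alters no state before that round. *)
pose x : 'I_N * 'I_T.+1 := (n, inord t).
have draws_upd (v : {ffun 'I_N * 'I_T.+1 -> 'I_K.+1}) k m i : (i <= T)%N ->
    draws_of [ffun y => if y == x then k else v y] m i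
    = if (m == n) && (i == t) then k else draws_of v m i.
  move=> iT; rewrite /draws_of ffunE /x xpair_eqE.
  congr (if _ then _ else _); congr (_ && _).
  apply/eqP/eqP => [/(congr1 val)|->//].
  by rewrite /= !inordK // ltnS // ltnW.
have state_upd (v : {ffun 'I_N * 'I_T.+1 -> 'I_K.+1}) k m :
    hop_state (draws_of [ffun y => if y == x then k else v y]) t m
    = hop_state (draws_of v) t m.
  apply: eq_hop_state => p i it.
  rewrite draws_upd; last by apply: ltnW; apply: leq_trans it (ltnW tT).
  by rewrite (ltn_eqF it) andbF.
apply: (@card_escape _ _ x) => [v k|v].
  rewrite /B /= hop_stateS -(state_upd v k).
  by case: (hop_state _ t n).
move=> /= hv.
pose occ := [set hopping_arm (draws_of v) t m | m in [set~ n]]%SET.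
have /subsetPn [k _ hk] : ~~ ([set: 'I_K.+1]%SET \subset occ).
  apply/negP => /subset_leq_card; rewrite cardsT card_ord leqNgt => /negP; apply.
  apply: leq_ltn_trans (leq_imset_card _ _) _.
  by rewrite cardsC1 card_ord -ltnS prednK // (leq_ltn_trans _ (ltn_ord n)).
exists k; rewrite negbK hop_stateS state_upd.
case hn: (hop_state _ t n) hv => [//|] _.
case: existsP => // -[m /andP[mn /eqP]].
rewrite /hopping_arm !state_upd !draws_upd ?(ltnW tT) // eqxx (negbTE mn) /= hn /=.
move=> e'; case/negP: hk; apply/imsetP; exists m; first by rewrite !inE.
by rewrite eqxx /= in e'; rewrite -e'.
Qed.

Lemma card_unsettled (N K T t : nat) (n : 'I_N) : (N <= K)%N -> (t <= T)%N ->
  (K ^ t * #|[pred v : {ffun 'I_N * 'I_T.+1 -> 'I_K} |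
                  ~~ hop_state (draws_of v) t n]|
   <= K.-1 ^ t * K ^ (N * T.+1))%N.
Proof.
case: K => [|K]; last exact: card_unsettled_succ.
by move=> N0; have := leq_trans (ltn_ord n) N0.
Qed.

(** * Runs in which all players settle *)

(** The number of players that a player infers equals [N] only by a proof. Comparing indices as
    natural numbers avoids transporting matrices along it. *)
Lemma eq_assign (R : realType) (K : nat)
    (assign : forall N : nat, 'M[R]_(N, K) -> 'I_N -> 'I_K)
    (n1 n2 : nat) (M1 : 'M[R]_(n1, K)) (M2 : 'M[R]_(n2, K)) (i1 : 'I_n1) (i2 : 'I_n2) :
  n1 = n2 -> i1 = i2 :> nat ->
  (forall (a : 'I_n1) (b : 'I_n2) c, a = b :> nat -> M1 a c = M2 b c) ->
  assign n1 M1 i1 = assign n2 M2 i2.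
Proof.
move=> e; case: n2 / e M2 i2 => M2 i2 /val_inj -> h; congr (assign _ _ _).
by apply/matrixP => a c; apply: h.
Qed.

(* [doa_action] with every dependence on the history passed as an argument, so
   that histories can be replaced without transport along [nplayers]. *)
Definition doa_core (R : realType) (K Ts Tr Tb : nat)
    (assign : forall N : nat, 'M[R]_(N, K) -> 'I_N -> 'I_K)
    (f hop : 'I_K) (busy : nat -> bool) (sb : 'I_K -> nat -> bool) (t : nat) :
    action K :=
  let A := [set i : 'I_K | (i != f) && busy (Tr + i)%N]%SET in
  let own : 'I_#|A|.+1 := inord #|[set j in A | (j < f)%N]%SET| in
  let start := (Tr + K + K * Ts)%N in
  if (t < Tr)%N then play hop
  else if (t < Tr + K)%N then
    let j := insubd f (t - Tr)%N in if j == f then play j else observe j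
  else if (t < start)%N then play (insubd f ((f + (t - (Tr + K))) %% K)%N)
  else if (t < start + #|A|.+1 * K * Tb)%N then
    let frame := ((t - start) %/ Tb)%N in
    let j := insubd f (frame %% K)%N in
    if ((frame %/ K)%N == own) && sb j ((t - start) %% Tb)%N then play j else observe j
  else play (assign #|A|.+1 (\matrix_(i, j) decode_bits R Tb (fun b =>
    if i == own then sb j b else busy (start + (i * K + j) * Tb + b)%N)) own).

Lemma doa_actionE (R : realType) (K Ts Tr Tb : nat)
    (assign : forall N : nat, 'M[R]_(N, K) -> 'I_N -> 'I_K)
    (u : nat -> 'I_K) (h : seq (observation R K)) :
  doa Ts Tr Tb assign u h =
  doa_core Ts Tr Tb assign (final_arm Tr u h) (hop_arm Tr u h (size h))
    (fun i => obs_busy (past Tr u h i))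
    (fun j => signal_bit Tb (mean_estimate Ts Tr u h j)) (size h).
Proof. by []. Qed.

(** * The run, phase by phase *)

Section Run.
Context (R : realType) (K Ts Tr Tb N : nat).
Context (assign : forall N : nat, 'M[R]_(N, K) -> 'I_N -> 'I_K).
Context (u : 'I_N -> nat -> 'I_K) (s : nat -> 'I_N -> 'I_K -> R).

Let hist := history (fun=> doa Ts Tr Tb assign) u s.

Definition run_action (t : nat) (n : 'I_N) : action K :=
  doa Ts Tr Tb assign (u n) (hist t n).

Definition run_observation (n : 'I_N) (t : nat) : observation R K :=
  Observation (run_action t n) (payoff (s t) (run_action t) n)
    (someone_else (run_action t) n).

Lemma history_mkseq t n : hist t n = mkseq (run_observation n) t.
Proof. by elim: t n => // t ih n; rewrite mkseqS -ih. Qed.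

Lemma size_hist t n : size (hist t n) = t.
Proof. by rewrite history_mkseq size_mkseq. Qed.

Lemma past_hist t n i : (i < t)%N -> past Tr (u n) (hist t n) i = run_observation n i.
Proof. by move=> it; rewrite /past history_mkseq nth_mkseq. Qed.

Lemma take_hist t n : (Tr <= t)%N -> take Tr (hist t n) = hist Tr n.
Proof.
by move=> Trt; rewrite !history_mkseq /mkseq -map_take take_iota (minn_idPl Trt).
Qed.

Let heard t n := [seq obs_arm o | o <- hist t n & ~~ obs_busy o].

(** Ties the policy to [hop_state]. The induction treats all players at once, since collisions
    depend on everybody's arm. *)
Lemma heard_hop t n : (t <= Tr)%N -> ohead (heard t n) = hop_state u t n.
Proof.
elim: t n => // t ih n tTr.
have arm_hop m : run_action t m = play (hopping_arm u t m).
  rewrite /run_action doa_actionE /doa_core size_hist tTr /hop_arm.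
  rewrite take_oversize ?size_hist ?(ltnW tTr) //.
  congr play; rewrite /hopping_arm -ih ?(ltnW tTr) // -/(heard t m).
  by case: (heard t m).
rewrite hop_stateS -ih ?(ltnW tTr) // /heard !history_mkseq mkseqS -history_mkseq.
rewrite filter_rcons /= -/(heard t n).
have -> : someone_else (run_action t) n =
    [exists m : 'I_N, (m != n) && (hopping_arm u t m == hopping_arm u t n)].
  apply: eq_existsb => m; rewrite !arm_hop /=; congr (_ && _).
  by apply/eqP/eqP => [[]|->].
case: ifP => [/negbTE ->|/negbFE ->] /=; rewrite ?map_rcons -/(heard t n).
  by rewrite /obs_arm /= arm_hop /= /hopping_arm -ih ?(ltnW tTr) //; case: (heard t n).
by case: (heard t n).
Qed.

Hypothesis settled : forall n, hop_state u Tr n.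

Let F := hopping_arm u Tr.

(** A settled player has had a collision-free round, so neither default is reached: round [Tr.-1] in
    [final_arm], round [Tr] in [hopping_arm]. *)
Lemma final_arm_hist t n : (Tr <= t)%N -> final_arm Tr (u n) (hist t n) = F n.
Proof.
move=> Trt; rewrite /final_arm /hop_arm take_hist // -/(heard Tr n) /F /hopping_arm.
by have := settled n; rewrite -heard_hop //; case: (heard Tr n).
Qed.

Lemma final_inj : injective F.
Proof. by move=> n m; apply: hopping_arm_inj. Qed.

Lemma action_announce (i : 'I_K) n : run_action (Tr + i) n = (i, i == F n).
Proof.
rewrite /run_action doa_actionE /doa_core size_hist ltnNge leq_addr /= ltn_add2l ltn_ord.
by rewrite addKn valKd final_arm_hist ?leq_addr //; case: ifP.
Qed.

Lemma busy_announce (i : 'I_K) n t : (Tr + K <= t)%N ->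
  obs_busy (past Tr (u n) (hist t n) (Tr + i)) = [exists m, (m != n) && (F m == i)].
Proof.
move=> Kt; rewrite past_hist /=; last by rewrite (leq_trans _ Kt) // ltn_add2l.
apply: eq_existsb => m; rewrite !action_announce xpair_eqE eqxx /= eqb_id.
by rewrite (eq_sym i).
Qed.

Let A n t := [set i : 'I_K | (i != final_arm Tr (u n) (hist t n)) &&
  obs_busy (past Tr (u n) (hist t n) (Tr + i))]%SET.

Lemma othersE n t : (Tr + K <= t)%N -> A n t = (F @: [set~ n])%SET.
Proof.
move=> Kt; apply/setP => i; rewrite inE busy_announce // final_arm_hist; last first.
  by apply: leq_trans Kt; apply: leq_addr.
apply/andP/imsetP => [[_ /existsP[m /andP[mn /eqP <-]]]|[m]].
  by exists m => //; rewrite !inE.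
rewrite !inE => mn ->; split; first by apply: contra mn => /eqP /final_inj ->.
by apply/existsP; exists m; rewrite mn eqxx.
Qed.

Lemma card_othersS n t : (Tr + K <= t)%N -> #|A n t|.+1 = N.
Proof.
move=> Kt; rewrite othersE // card_imset; last exact: final_inj.
by rewrite cardsC1 card_ord prednK // (leq_ltn_trans _ (ltn_ord n)).
Qed.

(** The index, from 0, that player [n] gives herself; [own_indexE] shows that she computes it
    correctly. *)
Definition arm_rank (n : 'I_N) : nat := #|[set m : 'I_N | (F m < F n)%N]%SET|.

Lemma arm_rank_lt n : (arm_rank n < N)%N.
Proof.
rewrite -[ltnRHS]card_ord -cardsT; apply: proper_card; rewrite properE finset.subsetT /=.
by apply/fintype.subsetPn; exists n; rewrite !inE ?ltnn.
Qed.

Lemma arm_rank_inj : injective arm_rank.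
Proof.
have lt n m : (F n < F m)%N -> (arm_rank n < arm_rank m)%N.
  move=> nm; apply: proper_card; rewrite properE; apply/andP; split.
    by apply/fintype.subsetP => i; rewrite !inE => /ltn_trans; apply.
  by apply/fintype.subsetPn; exists n; rewrite !inE ?ltnn.
move=> n m e; apply: final_inj; apply: val_inj.
by case: (ltngtP (F n) (F m)) => // /lt; rewrite e ltnn.
Qed.

Lemma own_indexE n t : (Tr + K <= t)%N ->
  (inord #|[set j in A n t | (j < final_arm Tr (u n) (hist t n))%N]%SET| : 'I_#|A n t|.+1)
  = arm_rank n :> nat.
Proof.
move=> Kt; rewrite inordK; last first.
  by rewrite ltnS; apply/subset_leq_card/fintype.subsetP => i; rewrite inE => /andP[].
rewrite final_arm_hist; last by apply: leq_trans Kt; apply: leq_addr.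
rewrite othersE // /arm_rank -(card_imset _ final_inj).
apply: eq_card => i; rewrite !inE; apply/andP/imsetP => [[/imsetP[m _ ->] mn]|[m]].
  by exists m => //; rewrite inE.
rewrite inE => mn ->; split=> //; apply: imset_f; rewrite !inE.
by apply: contraTneq mn => ->; rewrite ltnn.
Qed.

Definition cyclic_arm n i : 'I_K := insubd (F n) ((F n + i) %% K)%N.

Lemma val_cyclic_arm n i : cyclic_arm n i = ((F n + i) %% K)%N :> nat.
Proof.
by rewrite /cyclic_arm val_insubd ltn_mod (leq_ltn_trans _ (ltn_ord (F n))).
Qed.

(** Distinct starting arms stay distinct under a common shift: the sequential phase has no
    collision. *)
Lemma cyclic_arm_inj i : injective (cyclic_arm^~ i).
Proof.
move=> n m /(congr1 val); rewrite /= !val_cyclic_arm => /eqP.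
by rewrite eqn_modDr !modn_small // => /eqP/val_inj/final_inj.
Qed.

Lemma action_sequential i n : (i < K * Ts)%N ->
  run_action (Tr + K + i) n = play (cyclic_arm n i).
Proof.
move=> iK; rewrite /run_action doa_actionE /doa_core size_hist.
rewrite -addnA ltnNge leq_addr /= addnA ltnNge leq_addr /= ltn_add2l iK addKn.
by rewrite final_arm_hist // -addnA leq_addr.
Qed.

(** The estimate as a function of the rewards [x] and the starting arm [k] alone, so that fixing the
    draws fixes the sampling times. *)
Definition sample_mean (x : nat -> R) (k j : nat) : R :=
  (\sum_(i < K * Ts | ((k + i) %% K == j)%N) x (Tr + K + i)%N) / Ts%:R.

Let est n (j : 'I_K) : R := sample_mean (fun t => s t n j) (F n) j.

Lemma mean_estimateE n t j : (Tr + K + K * Ts <= t)%N ->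
  mean_estimate Ts Tr (u n) (hist t n) j = est n j.
Proof.
move=> Kt; rewrite /mean_estimate /est /sample_mean; congr (_ / _).
have pastE (i : 'I_(K * Ts)) : past Tr (u n) (hist t n) (seq_start K Tr + i) =
    run_observation n (Tr + K + i).
  by rewrite past_hist // (leq_trans _ Kt) // ltn_add2l.
apply: eq_big => i.
  by rewrite pastE /obs_arm /= action_sequential // -val_eqE /= val_cyclic_arm.
rewrite pastE /obs_arm /= /payoff.
have -> : someone_else (run_action (Tr + K + i)) n = false.
  apply/negbTE/existsP => -[m /andP[mn]]; rewrite !action_sequential //= => /eqP[].
  by move/cyclic_arm_inj => e; rewrite e eqxx in mn.
by rewrite action_sequential //= => /eqP ->.
Qed.

Let start := (Tr + K + K * Ts)%N.

(** The offset of the round is a mixed-radix numeral with digits [i], [j], [b], which division by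
    [Tb] and then by [K] recovers. *)
Lemma action_signal (i : 'I_N) (j : 'I_K) b n : (b < Tb)%N ->
  run_action (start + (i * K + j) * Tb + b) n =
  (j, (i == arm_rank n :> nat) && signal_bit Tb (est n j) b).
Proof.
move=> bT; set t := (start + _ + _)%N.
have startt : (start <= t)%N by rewrite /t -addnA leq_addr.
have Kt : (Tr + K <= t)%N by apply: leq_trans startt; apply: leq_addr.
have Trt : (Tr <= t)%N by apply: leq_trans Kt; apply: leq_addr.
rewrite /run_action doa_actionE /doa_core size_hist.
rewrite ltnNge Trt /= ltnNge Kt /= ltnNge -/start startt /= -/(A n t).
have K0 : (0 < K)%N by apply: leq_ltn_trans (ltn_ord j).
have Tb0 : (0 < Tb)%N by apply: leq_ltn_trans bT.
have -> : (t < start + #|A n t|.+1 * K * Tb)%N.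
  rewrite card_othersS // /t -addnA ltn_add2l.
  apply: (@leq_trans ((i * K + j).+1 * Tb)); first by rewrite mulSn addnC ltn_add2r.
  rewrite leq_mul2r; apply/orP; right.
  apply: (@leq_trans (i.+1 * K)); first by rewrite mulSn addnC ltn_add2r.
  by rewrite leq_mul2r ltn_ord orbT.
rewrite own_indexE // final_arm_hist //.
have -> : (t - start = (i * K + j) * Tb + b)%N by rewrite /t -addnA addKn.
rewrite divnMDl // (divn_small bT) addn0 (modnMDl _ b) (modn_small bT).
rewrite divnMDl // (divn_small (ltn_ord j)) addn0 modnMDl (modn_small (ltn_ord j)) valKd.
by rewrite mean_estimateE //; case: ifP.
Qed.

Definition arm_index n : 'I_N := Ordinal (arm_rank_lt n).

(** Her own row comes from her own bits, the other rows from what she hears; both are the decoded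
    signals, so all players hold the same matrix [D]. *)
Lemma action_commit (D : 'M[R]_(N, K)) t n : (start + N * K * Tb <= t)%N ->
  (forall m j, D (arm_index m) j = decode_bits R Tb (signal_bit Tb (est m j))) ->
  run_action t n = play (assign D (arm_index n)).
Proof.
move=> Nt hD.
have startt : (start <= t)%N by apply: leq_trans Nt; apply: leq_addr.
have Kt : (Tr + K <= t)%N by apply: leq_trans startt; apply: leq_addr.
have Trt : (Tr <= t)%N by apply: leq_trans Kt; apply: leq_addr.
rewrite /run_action doa_actionE /doa_core size_hist.
rewrite ltnNge Trt /= ltnNge Kt /= ltnNge -/start startt /= -/(A n t).
have -> : (t < start + #|A n t|.+1 * K * Tb)%N = false.
  by rewrite card_othersS // ltnNge Nt.
congr play; apply: eq_assign; [exact: card_othersS | exact: own_indexE |].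
move=> a b c ab; rewrite mxE.
(* Every row has a sender: row [b] belongs to player [g b]. *)
have [g _ gK] : bijective arm_index.
  by apply: injF_bij => x y /(congr1 val) /= /arm_rank_inj.
rewrite -(gK b) hD; set m := g b.
have am : a = arm_rank m :> nat by rewrite ab -(gK b).
apply: eq_bigr => /= k _; congr (_%:R / _); congr nat_of_bool.
rewrite -val_eqE /= own_indexE // am (inj_eq arm_rank_inj).
case: (eqVneq m n) => [->|mn]; first by rewrite mean_estimateE.
rewrite past_hist /=; last first.
  apply: leq_trans Nt; rewrite -addnA ltn_add2l.
  apply: (@leq_trans ((arm_rank m * K + c).+1 * Tb)).
    by rewrite mulSn addnC ltn_add2r.
  rewrite leq_mul2r; apply/orP; right.
  apply: (@leq_trans ((arm_rank m).+1 * K)); first by rewrite mulSn addnC ltn_add2r.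
  by rewrite leq_mul2r arm_rank_lt orbT.
have actE m' := action_signal (arm_index m) c m' (ltn_ord k).
rewrite /someone_else /=; under eq_existsb do rewrite !actE /=.
(* In this frame only player [m] can play: a busy arm means that her bit is 1, and as [m != n] her
   play is heard by [n]. *)
apply/existsP/idP => [[m' /andP[_ /eqP[]]]|h].
  by case: eqP => //= /arm_rank_inj -> .
by exists m; rewrite mn eqxx /= h.
Qed.

End Run.

(** * Binary encoding, sampling times and near-optimality *)

Lemma sum_bits (t c : nat) : (\sum_(i < t) odd (c %/ 2 ^ i) * 2 ^ i = c %% 2 ^ t)%N.
Proof.
elim: t => [|t ih]; first by rewrite big_ord0 expn0 modn1.
rewrite big_ord_recr /= ih.
(* Bit [t] is split off as the parity of the quotient by [2 ^ t]. *)
have {3}-> : c = ((c %/ 2 ^ t)./2 * 2 ^ t.+1 + (c %% 2 ^ t + odd (c %/ 2 ^ t) * 2 ^ t))%N.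
  rewrite {1}(divn_eq c (2 ^ t)); set q := (c %/ _)%N.
  by rewrite -{1}[q]odd_double_half expnS -muln2; ring.
rewrite modnMDl [RHS]modn_small // expnS mul2n -addnn -addSn leq_add ?ltn_mod ?expn_gt0 //.
by case: (odd _); rewrite ?mul1n ?mul0n.
Qed.

(** The decoded value is [c / 2 ^ Tb]. The cap in [c] acts only at [x = 1], where the error is
    exactly [2 ^ - Tb]. *)
Lemma decode_signal (R : realType) (Tb : nat) (x : R) : 0 <= x <= 1 ->
  `|decode_bits R Tb (signal_bit Tb x) - x| <= (2 ^+ Tb)^-1.
Proof.
move=> /andP[x0 x1].
have p0 : 0 < 2 ^+ Tb :> R by rewrite exprn_gt0.
set c := minn (Num.truncn (x * 2 ^+ Tb)) (2 ^ Tb).-1.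
have c_lt : (c < 2 ^ Tb)%N.
  by rewrite /c (leq_ltn_trans (geq_minr _ _)) // prednK ?expn_gt0.
have -> : decode_bits R Tb (signal_bit Tb x) = c%:R / 2 ^+ Tb.
  rewrite -[c in RHS](modn_small c_lt) -sum_bits natr_sum mulr_suml /decode_bits.
  (* Bits are sent most significant first, whereas [sum_bits] starts from the least significant
     one. *)
  rewrite [RHS](reindex_inj rev_ord_inj) /=; apply: eq_bigr => b _.
  rewrite /signal_bit -/c natrM natrX -mulrA; congr (_ * _).
  have -> : 2 ^+ Tb = 2 ^+ (Tb - b.+1) * 2 ^+ b.+1 :> R by rewrite -exprD subnK.
  by rewrite invfM mulrA divff ?mul1r // expf_neq0.
have y0 : 0 <= x * 2 ^+ Tb by rewrite mulr_ge0 // ltW.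
have /andP[t1 t2] := truncn_itv y0.
have cx : c%:R <= x * 2 ^+ Tb.
  by apply: le_trans t1; rewrite ler_nat geq_minl.
have xc : x * 2 ^+ Tb <= c%:R + 1.
  rewrite natr1; rewrite /c /minn; case: ifP => _; first exact: ltW.
  by rewrite prednK ?expn_gt0 // natrX ler_piMl // ltW.
rewrite ler_norml; apply/andP; split.
  rewrite lerBrDr addrC lerBlDr -[X in _ + X]mul1r -mulrDl.
  by rewrite ler_pdivlMr.
apply: (@le_trans _ _ 0); last by rewrite invr_ge0 ltW.
by rewrite subr_le0 ler_pdivrMr.
Qed.

(** Each block of [K] rounds meets arm [j] exactly once, at offset [j - k] modulo [K], written with
    [K - k] to stay within the natural numbers. *)
Lemma cyclic_sum (R : pzRingType) (K k j : nat) (Ts : nat) (x : nat -> R) :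
    (k < K)%N -> (j < K)%N ->
  \sum_(i < K * Ts | ((k + i) %% K == j)%N) x i =
  \sum_(q < Ts) x (K * q + (j + (K - k)) %% K)%N.
Proof.
move=> kK jK; have K0 : (0 < K)%N by apply: leq_ltn_trans kK.
elim: Ts => [|Ts ih]; first by rewrite muln0 !big_ord0.
rewrite big_ord_recr -ih /= big_mkcond [in RHS]big_mkcond /= mulnSr big_split_ord /=.
congr (_ + _); set r := ((j + (K - k)) %% K)%N.
have rK : (r < K)%N by rewrite ltn_mod.
have kr : ((k + r) %% K = j)%N.
  by rewrite modnDmr addnCA subnKC ?modnDr ?modn_small // ltnW.
rewrite (bigD1 (Ordinal rK)) //= big1 ?addr0 => [|i].
  by rewrite addnCA mulnC modnMDl kr eqxx.
rewrite -val_eqE /= addnCA mulnC modnMDl -kr eqn_modDl !modn_small //.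
by move=> /negbTE ->.
Qed.

Lemma sample_meanE (R : realType) (K Ts Tr : nat) (x : nat -> R) (k j : 'I_K) :
  sample_mean K Ts Tr x k j =
  (\sum_(q < Ts) x (Tr + K + (K * q + (j + (K - k)) %% K))%N) / Ts%:R.
Proof. by rewrite /sample_mean (cyclic_sum Ts (fun i => x (Tr + K + i)%N)). Qed.

Lemma sample_mean_itv (R : realType) (K Ts Tr : nat) (x : nat -> R) (k j : 'I_K) :
  (forall t, 0 <= x t <= 1) -> 0 <= sample_mean K Ts Tr x k j <= 1.
Proof.
move=> x01; rewrite sample_meanE; apply/andP; split.
  rewrite divr_ge0 ?sumr_ge0 // => q _.
  by case/andP: (x01 (Tr + K + (K * q + (j + (K - k)) %% K))%N).
case: Ts => [|Ts]; first by rewrite invr0 mulr0.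
rewrite ler_pdivrMr ?ltr0n // mul1r; apply: (@le_trans _ _ (\sum_(q < Ts.+1) 1)).
  by apply: ler_sum => q _; case/andP: (x01 (Tr + K + (K * q + (j + (K - k)) %% K))%N).
by rewrite sumr_const card_ord.
Qed.

(** Estimation and truncation each move an entry by at most [tau], so the value of any assignment
    moves by at most [N * 2 tau]. This is paid twice: for [pi] and for the assignment chosen from
    [D]. *)
Lemma doa_near_optimal (R : realType) (K Ts Tr Tb N : nat)
    (assign : forall N : nat, 'M[R]_(N, K) -> 'I_N -> 'I_K)
    (u : 'I_N -> nat -> 'I_K) (s : nat -> 'I_N -> 'I_K -> R)
    (mu : 'M[R]_(N, K)) (tau : R) (pi : 'I_N -> 'I_K) (t : nat) :
  (forall M : 'M[R]_(N, K), optimal_assignment M (assign N M)) ->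
  (forall t n k, 0 <= s t n k <= 1) ->
  (2 ^+ Tb)^-1 <= tau ->
  (forall n, hop_state u Tr n) ->
  (forall n (j : 'I_K), `|sample_mean K Ts Tr (fun t => s t n j) (hopping_arm u Tr n) j
                 - mu n j| <= tau) ->
  (Tr + K + K * Ts + N * K * Tb <= t)%N -> injective pi ->
  \sum_n mu n (pi n) - N%:R * (4 * tau) <=
  \sum_n mu n (selected_arm (fun=> doa Ts Tr Tb assign) u s t n).
Proof.
move=> hassign s01 Tb_tau settled est_tau tT pi_inj.
have rkI : injective (arm_index Tr u).
  by move=> n m /(congr1 val); apply: arm_rank_inj.
have [g rkK gK] := injF_bij rkI.
pose est n (j : 'I_K) := sample_mean K Ts Tr (fun t => s t n j) (hopping_arm u Tr n) j.
pose D : 'M[R]_(N, K) := \matrix_(i, j) decode_bits R Tb (signal_bit Tb (est (g i) j)).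
have DE m j : D (arm_index Tr u m) j = decode_bits R Tb (signal_bit Tb (est m j)).
  by rewrite mxE rkK.
have selE n : selected_arm (fun=> doa Ts Tr Tb assign) u s t n = assign N D (arm_index Tr u n).
  exact: (congr1 fst (action_commit assign settled n tT DE)).
have D_mu n j : `|D (arm_index Tr u n) j - mu n j| <= 2 * tau.
  rewrite DE; have e01 : 0 <= est n j <= 1 by apply: sample_mean_itv.
  have := decode_signal Tb e01; have := est_tau n j; rewrite -/(est n j).
  set x := decode_bits _ _ _; set y := est n j => h1 h2.
  have -> : x - mu n j = (x - y) + (y - mu n j) by ring.
  by apply: le_trans (ler_normD _ _) _; lra.
(* Rows of [D] are ordered by index and [g] sends an index to its player, so [pi \o g] is [pi] read
   on the rows. *)
have [_ /(_ (pi \o g))] := hassign D.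
have gI : injective g by apply: can_inj gK.
move=> /(_ (inj_comp pi_inj gI)).
rewrite (reindex_inj rkI) [X in _ <= X](reindex_inj rkI) /=.
under eq_bigr do rewrite rkK; move=> D_opt.
have sum_D (pi' : 'I_N -> 'I_K) :
    `|\sum_n D (arm_index Tr u n) (pi' n) - \sum_n mu n (pi' n)| <= N%:R * (2 * tau).
  rewrite -sumrB; apply: le_trans (ler_norm_sum _ _ _) _.
  apply: (@le_trans _ _ (\sum_(n < N) 2 * tau)); first by apply: ler_sum => n _.
  by rewrite sumr_const card_ord -[leLHS]mulr_natl.
under [leRHS]eq_bigr do rewrite selE.
have := sum_D pi; have := sum_D (assign N D \o arm_index Tr u).
by move: D_opt; rewrite /= !ler_norml => h1 /andP[h2 h3] /andP[h4 h5]; lra.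
Qed.

(** * Measurability of the selected arms *)

(** Rewards influence an action only through the truncated estimates, and draws only through the
    current round and round [Tr.-1], the default of [final_arm]. All these data are countable. *)
Lemma eq_doa (R : realType) (K Ts Tr Tb : nat)
    (assign : forall N : nat, 'M[R]_(N, K) -> 'I_N -> 'I_K)
    (u v : nat -> 'I_K) (h g : seq (observation R K)) :
  u (size h) = v (size h) -> u Tr.-1 = v Tr.-1 ->
  [seq (obs_action o, obs_busy o) | o <- h] =
    [seq (obs_action o, obs_busy o) | o <- g] ->
  (forall j, Num.truncn (mean_estimate Ts Tr u h j * 2 ^+ Tb) =
             Num.truncn (mean_estimate Ts Tr v g j * 2 ^+ Tb)) ->
  doa Ts Tr Tb assign u h = doa Ts Tr Tb assign v g.
Proof.
move=> uvt uvT hg est_eq.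
have size_eq : size h = size g by have := congr1 size hg; rewrite !size_map.
have hop_eq t : u t = v t -> hop_arm Tr u h t = hop_arm Tr v g t.
  have hopE (f : seq (observation R K)) :
      [seq obs_arm o | o <- take Tr f & ~~ obs_busy o] =
      [seq p.1.1 | p <- take Tr [seq (obs_action o, obs_busy o) | o <- f] & ~~ p.2].
    by rewrite -map_take filter_map -map_comp.
  by rewrite /hop_arm !hopE hg => ->.
have final_eq : final_arm Tr u h = final_arm Tr v g by exact: hop_eq.
have busy_eq : (fun i => obs_busy (past Tr u h i)) = (fun i => obs_busy (past Tr v g i)).
  apply/funext => i; have busyE (w : nat -> 'I_K) (f : seq (observation R K)) :
      obs_busy (past Tr w f i) =
      (nth (observe (final_arm Tr w f), false)
          [seq (obs_action o, obs_busy o) | o <- f] i).2.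
    rewrite /past; have [fi|fi] := ltnP i (size f).
      by rewrite (nth_map (Observation (observe (final_arm Tr w f)) 0 false)).
    by rewrite !nth_default ?size_map.
  by rewrite !busyE hg final_eq.
rewrite !doa_actionE -size_eq final_eq (hop_eq _ uvt) busy_eq.
congr doa_core; apply/funext => j; apply/funext => b.
by rewrite /signal_bit est_eq.
Qed.

Section DiscreteMeasurability.
Context (d : measure_display) (T : measurableType d).

(** [A] is the union of its traces on the fibres of [f], enumerated by [pickle]. *)
Lemma measurable_fibers (C : countType) (f : T -> C) (A : set T) :
  (forall c, measurable (A `&` [set w | f w = c])) -> measurable A.
Proof.
move=> mA; have -> : A = \bigcup_k
    (if unpickle k is Some c then A `&` [set w | f w = c] else set0).
  apply/seteqP; split=> [w Aw|w [k _]]; first by exists (pickle (f w)); rewrite ?pickleK.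
  by case: unpickle => // c [].
by apply: bigcup_measurable => k _; case: unpickle.
Qed.

Lemma measurable_forall (I : finType) (A : I -> set T) :
  (forall i, measurable (A i)) -> measurable [set w | forall i, A i w].
Proof.
move=> mA; have -> : [set w | forall i, A i w] = \bigcap_(i in [set: I]) A i.
  by apply/seteqP; split=> [w Aw i _|w Aw i]; exact: Aw.
by apply: fin_bigcap_measurable => //; apply: finite_finset.
Qed.

End DiscreteMeasurability.

(** * Induction on the list of past actions *)

Section Trajectories.
Context (d : measure_display) (T : measurableType d) (R : realType).
Context (K Ts Tr Tb N : nat).
Context (assign : forall N : nat, 'M[R]_(N, K) -> 'I_N -> 'I_K).
Context (U : 'I_N -> nat -> T -> 'I_K) (S : 'I_N -> 'I_K -> nat -> T -> R).
Hypothesis mU : forall n t k, measurable [set w | U n t w = k].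
Hypothesis mS : forall n k t, measurable_fun setT (S n k t).

Let u w n t := U n t w.
Let s w t n k := S n k t w.
Let act w := run_action Ts Tr Tb assign (u w) (s w).

Section FixedActions.
Context (a : nat -> 'I_N -> 'I_K * bool) (n : 'I_N) (t : nat).

(** The history of player [n] if all past actions were the given [a]: only the rewards in it are
    random. *)
Let h w := mkseq (fun i => Observation (a i n : action K) (payoff (s w i) (a i) n)
  (someone_else (a i) n)) t.

Let measurable_estimate (v : nat -> 'I_K) j :
  measurable_fun setT (fun w => mean_estimate Ts Tr v (h w) j).
Proof.
pose x i := (seq_start K Tr + i)%N.
have -> : (fun w => mean_estimate Ts Tr v (h w) j) = (fun w =>
    (\sum_(i < K * Ts) (if [&& (x i < t)%N, (a (x i) n).1 == j, (a (x i) n).2 &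
        ~~ someone_else (a (x i)) n] then S n (a (x i) n).1 (x i) w else 0)) * Ts%:R^-1).
  apply/funext => w; rewrite /mean_estimate big_mkcond /=; congr (_ * _).
  apply: eq_bigr => i _; rewrite -/(x i) /past; case: (ltnP (x i) t) => xt /=.
    by rewrite nth_mkseq // /obs_arm /= /payoff; case: ifP.
  by rewrite nth_default ?size_mkseq //=; case: ifP.
apply: measurable_funM => //; apply: measurable_sum => i.
case: [&& (x i < t)%N, (a (x i) n).1 == j, (a (x i) n).2 &
  ~~ someone_else (a (x i)) n] => //.
Qed.

Lemma measurable_doa_fixed b : measurable [set w | doa Ts Tr Tb assign (u w n) (h w) = b].
Proof.
apply: (measurable_fibers (f := fun w => (U n t w, U n Tr.-1 w))) => -[k1 k2].
(* A fixed sequence carrying the two relevant draws; if [t = Tr.-1] they coincide on the event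
   considered. *)
pose v i := if i == t then k1 else k2.
have -> : [set w | doa Ts Tr Tb assign (u w n) (h w) = b] `&`
    [set w | (U n t w, U n Tr.-1 w) = (k1, k2)] =
    [set w | doa Ts Tr Tb assign v (h w) = b] `&`
    ([set w | U n t w = k1] `&` [set w | U n Tr.-1 w = k2]).
  have e w : U n t w = k1 -> U n Tr.-1 w = k2 ->
      doa Ts Tr Tb assign (u w n) (h w) = doa Ts Tr Tb assign v (h w).
    move=> e1 e2; have uv1 : u w n t = v t by rewrite /v eqxx.
    have uv2 : u w n Tr.-1 = v Tr.-1.
      by rewrite /v; case: eqP => [e3|//]; rewrite /u e3.
    apply: eq_doa => //; first by rewrite size_mkseq.
    move=> j; congr (Num.truncn (_ * _)); rewrite /mean_estimate.
    have fe : final_arm Tr (u w n) (h w) = final_arm Tr v (h w).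
      by rewrite /final_arm /hop_arm uv2.
    by rewrite /past fe.
  apply/seteqP; split=> w /= [db].
    by case=> e1 e2; rewrite -e.
  by case=> e1 e2; rewrite e // e1 e2.
apply: measurableI; last by apply: measurableI.
pose f w : {ffun 'I_K -> nat} :=
  [ffun j => Num.truncn (mean_estimate Ts Tr v (h w) j * 2 ^+ Tb)].
apply: (measurable_fibers (f := f)) => c.
have mf : measurable [set w | f w = c].
  have -> : [set w | f w = c] =
      [set w | forall j, Num.truncn (mean_estimate Ts Tr v (h w) j * 2 ^+ Tb) = c j].
    apply/seteqP; split=> w; first by move=> /= <- j; rewrite ffunE.
    by move=> e; apply/ffunP => j; rewrite ffunE e.
  apply: (measurable_forall (A := fun j => [set w | _ = c j])) => j.
  rewrite -[X in measurable X]setTI.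
  exact: (measurable_estimate v j measurableT (measurable_truncn_cell _ _)).
(* The action is constant on the fibre [f w = c], so the trace is the whole fibre or empty. *)
have [[w0 [w0b w0c]]|none] :=
    pselect (exists w0, doa Ts Tr Tb assign v (h w0) = b /\ f w0 = c).
  have -> : [set w | doa Ts Tr Tb assign v (h w) = b] `&` [set w | f w = c] =
      [set w | f w = c] => //.
  apply/seteqP; split=> w /=; first by case.
  move=> fc; split=> //; rewrite -w0b; apply: eq_doa => //.
    by rewrite /h /mkseq -!map_comp.
  by move=> j; move: fc; rewrite -w0c => /ffunP/(_ j); rewrite !ffunE.
have -> : [set w | doa Ts Tr Tb assign v (h w) = b] `&` [set w | f w = c] = set0 => //.
by apply/seteqP; split=> w // [? ?]; case: none; exists w.
Qed.

End FixedActions.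

(** Once the first [t] action profiles are prescribed, the histories are those of fixed actions, and
    [measurable_doa_fixed] handles the next profile. *)
Lemma measurable_actions t (c : seq {ffun 'I_N -> 'I_K * bool}) :
  measurable [set w | mkseq (fun i => [ffun n => (act w i n : 'I_K * bool)]) t = c].
Proof.
elim: t c => [|t ih] c.
  case: c => [|a c]; first by rewrite (_ : [set w | _] = setT) //; apply/seteqP; split.
  by rewrite (_ : [set w | _] = set0) //; apply/seteqP; split.
case/lastP: c => [|c p].
  by rewrite (_ : [set w | _] = set0) //; apply/seteqP; split.
pose a i n := nth [ffun=> p n] c i n.
have -> : [set w | mkseq (fun i => [ffun n => (act w i n : 'I_K * bool)]) t.+1 = rcons c p] =
    [set w | mkseq (fun i => [ffun n => (act w i n : 'I_K * bool)]) t = c] `&`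
    [set w | forall n, doa Ts Tr Tb assign (u w n)
       (mkseq (fun i => Observation (a i n : action K) (payoff (s w i) (a i) n)
          (someone_else (a i) n)) t) = p n].
  have e w n : mkseq (fun i => [ffun n => (act w i n : 'I_K * bool)]) t = c ->
     act w t n = doa Ts Tr Tb assign (u w n)
       (mkseq (fun i => Observation (a i n : action K) (payoff (s w i) (a i) n)
          (someone_else (a i) n)) t).
    move=> hc; rewrite /act /run_action history_mkseq; congr doa.
    apply/eq_in_map => i; rewrite mem_iota add0n => /= it.
    have ai : act w i = a i.
      by apply/funext => m; rewrite /a -hc nth_mkseq // ffunE.
    by rewrite /run_observation -/(act w) ai.
  apply/seteqP; split=> w; rewrite /mkset mkseqS.
    move=> /rcons_inj[hc hp]; split=> // n.
    by rewrite -e // -hp ffunE.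
  case=> hc hp; congr rcons => //; apply/ffunP => n.
  by rewrite ffunE e // hp.
apply: measurableI => //.
apply: (measurable_forall (A := fun n => [set w | _ = p n])) => n.
exact: measurable_doa_fixed.
Qed.

Lemma measurable_selected t (Q : set ('I_N -> 'I_K)) :
  measurable [set w | Q (selected_arm (fun=> doa Ts Tr Tb assign) (u w) (s w) t)].
Proof.
pose f w := mkseq (fun i => [ffun n => (act w i n : 'I_K * bool)]) t.+1.
apply: (measurable_fibers (f := f)) => c.
have mf : measurable [set w | f w = c] by exact: measurable_actions.
set A := [set w | Q _].
have fA w w' : f w = f w' -> A w -> A w'.
  move=> ff; rewrite /A /=; suff -> : selected_arm (fun=> doa Ts Tr Tb assign) (u w) (s w) t =
    selected_arm (fun=> doa Ts Tr Tb assign) (u w') (s w') t by [].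
  apply/funext => n; have := congr1 (fun c => nth [ffun=> act w t n : 'I_K * bool] c t n) ff.
  by rewrite /f !nth_mkseq // !ffunE /act /run_action /selected_arm => ->.
have [[w0 [w0A w0c]]|none] := pselect (exists w0, A w0 /\ f w0 = c).
  have -> : A `&` [set w | f w = c] = [set w | f w = c] => //.
  apply/seteqP; split=> w /=; first by case.
  by move=> fc; split=> //; apply: fA w0A; rewrite w0c.
have -> : A `&` [set w | f w = c] = set0 => //.
by apply/seteqP; split=> w // [? ?]; case: none; exists w.
Qed.

End Trajectories.

(** * Failure probabilities *)

Lemma nat_ceil_ge (R : realType) (x : R) : x <= (nat_ceil x)%:R.
Proof.
rewrite /nat_ceil natr_absz ger0_norm ?le_max ?lexx //.
by apply: le_trans (ceil_ge x) _; rewrite ler_int le_max lexx orbT.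
Qed.

Lemma packet_length_le (R : realType) (N : nat) (eps : R) : (0 < N)%N -> 0 < eps ->
  (2 ^+ packet_length N eps)^-1 <= eps / (4 * N%:R).
Proof.
move=> N0 e0; have N0' : 0 < N%:R :> R by rewrite ltr0n.
have p0 : 0 < 4 * N%:R / eps by rewrite divr_gt0 // mulr_gt0.
rewrite -[leRHS]invrK lef_pV2 ?posrE ?exprn_gt0 ?invr_gt0 ?divr_gt0 ?mulr_gt0 //.
rewrite invf_div -ler_ln ?posrE ?exprn_gt0 // lnXn // -[leRHS]mulr_natr [leRHS]mulrC.
have l2 : 0 < ln 2 :> R by rewrite ln_gt0 // ltr1n.
by rewrite -ler_pdivrMr //; apply: nat_ceil_ge.
Qed.

(** With deviation [eps / (4 N)] the Hoeffding exponent is [Ts eps ^ 2 / (8 N ^ 2)], at least [L];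
    the bound spreads [delta / 2] over the [N K] estimates. *)
Lemma samples_per_arm_le (R : realType) (N K : nat) (eps delta : R) :
  (0 < N)%N -> (0 < K)%N -> 0 < eps -> 0 < delta ->
  2 * expR (- (2 * (samples_per_arm N K eps delta)%:R * (eps / (4 * N%:R)) ^+ 2))
  <= delta / (2 * N%:R * K%:R).
Proof.
move=> N0 K0 e0 d0; set Ts := samples_per_arm _ _ _ _.
have N0' : 0 < N%:R :> R by rewrite ltr0n.
have K0' : 0 < K%:R :> R by rewrite ltr0n.
set L := ln (4 * N%:R * K%:R / delta).
have q0 : 0 < 4 * N%:R * K%:R / delta by rewrite divr_gt0 // !mulr_gt0.
have : L <= 2 * Ts%:R * (eps / (4 * N%:R)) ^+ 2.
  have : 8 * N%:R ^+ 2 / eps ^+ 2 * L <= Ts%:R by apply: nat_ceil_ge.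
  have c0 : 0 < 8 * N%:R ^+ 2 / eps ^+ 2 by rewrite divr_gt0 ?mulr_gt0 ?exprn_gt0.
  rewrite mulrC -ler_pdivlMr // => h; apply: le_trans h _.
  by rewrite le_eqVlt; apply/orP; left; apply/eqP; field; rewrite !gt_eqF.
rewrite -lerN2 => h.
have {}h : expR (- (2 * Ts%:R * (eps / (4 * N%:R)) ^+ 2)) <= (4 * N%:R * K%:R / delta)^-1.
  by apply: (@le_trans _ _ (expR (- L))); rewrite ?ler_expR // expRN lnK ?posrE.
apply: (@le_trans _ _ (2 * (4 * N%:R * K%:R / delta)^-1)); first by rewrite ler_wpM2l.
by rewrite le_eqVlt; apply/orP; left; apply/eqP; field; rewrite !gt_eqF.
Qed.

Lemma samples_per_arm_gt0 (R : realType) (N K : nat) (eps delta : R) :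
  (0 < N)%N -> (0 < K)%N -> 0 < eps -> 0 < delta < 1 ->
  (0 < samples_per_arm N K eps delta)%N.
Proof.
move=> N0 K0 e0 /andP[d0 d1]; rewrite -(ltr0n R); apply: lt_le_trans (nat_ceil_ge _).
have N1 : 1 <= N%:R :> R by rewrite ler1n.
have K1 : 1 <= K%:R :> R by rewrite ler1n.
rewrite mulr_gt0 ?divr_gt0 ?mulr_gt0 ?exprn_gt0 ?ltr0n // ln_gt0 //.
by rewrite ltr_pdivlMr // mul1r; nra.
Qed.

(** [1 - 1 / K] is at most [q = 1 - 1 / (4 K)], and [Tr] is chosen for the powers of [q]; division
    by [ln q < 0] reverses the inequality. *)
Lemma hopping_rounds_le (R : realType) (K : nat) (delta : R) :
  (0 < K)%N -> 0 < delta < 1 ->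
  (K.-1%:R / K%:R) ^+ hopping_rounds K delta <= delta / (2 * K%:R).
Proof.
case: K => // K _ /andP[d0 d1] /=; set Tr := hopping_rounds _ _.
have K1 : 1 <= K.+1%:R :> R by rewrite ler1n.
have K0 : 0 < K.+1%:R :> R by rewrite ltr0n.
set q : R := 1 - 1 / (4 * K.+1%:R).
have q0 : 0 < q.
  by rewrite /q subr_gt0 ltr_pdivrMr ?mulr_gt0 // mul1r; lra.
have q1 : q < 1 by rewrite /q ltrBlDr ltrDl divr_gt0 // mulr_gt0.
apply: (@le_trans _ _ (q ^+ Tr)).
  apply: lerXn2r; rewrite ?nnegrE ?divr_ge0 ?(ltW q0) //.
  rewrite ler_pdivrMr // /q.
  have -> : (1 - 1 / (4 * K.+1%:R)) * K.+1%:R = K.+1%:R - 1 / 4 :> R.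
    by field; rewrite gt_eqF.
  by rewrite -natr1; lra.
have b0 : 0 < delta / (2 * K.+1%:R) by rewrite divr_gt0 // mulr_gt0.
rewrite -ler_ln ?posrE ?exprn_gt0 // lnXn // -[leLHS]mulr_natr mulrC.
have lq : ln q < 0 by rewrite ln_lt0 // q0.
by rewrite -ler_ndivrMr //; apply: nat_ceil_ge.
Qed.

Definition mean_deviates (R : realType) (T : Type) (K Ts Tr : nat) (tau m : R)
    (X : nat -> T -> R) (k j : 'I_K) : set T :=
  [set w | tau < `|sample_mean K Ts Tr (fun t => X t w) k j - m|].

(** Applied both to the ambient sigma-algebra and to the one generated by the rewards. *)
Lemma measurable_mean_deviates (d : measure_display) (T : measurableType d)
    (R : realType) (K Ts Tr : nat) (tau m : R) (X : nat -> T -> R) (k j : 'I_K) :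
  (forall t, measurable_fun setT (X t)) ->
  measurable (mean_deviates Ts Tr tau m X k j).
Proof.
move=> mX.
have md : measurable_fun setT (fun w =>
    `|sample_mean K Ts Tr (fun t => X t w) k j - m|).
  apply: measurableT_comp => //; apply: measurable_funB => //.
  under eq_fun do rewrite sample_meanE.
  by apply: measurable_funM => //; apply: measurable_sum.
rewrite -[X in measurable X]setTI.
have -> : mean_deviates Ts Tr tau m X k j = (fun w =>
    `|sample_mean K Ts Tr (fun t => X t w) k j - m|) @^-1` [set` `]tau, +oo[%R].
  by apply/seteqP; split=> w /=; rewrite in_itv /= andbT.
exact: md.
Qed.

(** * Averaging over the draws *)

Section Probabilities.
Context (d : measure_display) (T : measurableType d) (R : realType).
Context (P : probability T R) (N K : nat) (mu : 'M[R]_(N, K)).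
Context (S : 'I_N -> 'I_K -> nat -> {RV P >-> R}) (U : 'I_N -> nat -> T -> 'I_K).
Hypotheses (hS : reward_process S mu) (hU : private_draws S U).

Let measurable_S n k t : measurable_fun setT (S n k t).
Proof. exact: measurable_funPT. Qed.

Lemma prob_mean_deviates (Ts Tr : nat) (tau : R) n (k j : 'I_K) :
  (0 < Ts)%N -> 0 <= tau ->
  fine (P (mean_deviates Ts Tr tau (mu n j) (S n j) k j)) <=
  2 * expR (- (2 * Ts%:R * tau ^+ 2)).
Proof.
move=> Ts0 tau0; have [S01 ES _ indep] := hS.
have K0 : (0 < K)%N by apply: leq_ltn_trans (ltn_ord j).
pose time (q : 'I_Ts) := (Tr + K + (K * q + (j + (K - k)) %% K))%N.
have timeI : injective time.
  move=> p q /eqP; rewrite eqn_add2l eqn_add2r eqn_mul2l gtn_eqF //= => /eqP.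
  exact: val_inj.
have := @hoeffding _ _ _ P Ts (fun q => S n j (time q)) (mu n j) tau Ts0.
have -> : [set w | tau < `|(\sum_i S n j (time i) w) / Ts%:R - mu n j|] =
    mean_deviates Ts Tr tau (mu n j) (S n j) k j.
  by apply/seteqP; split=> w; rewrite /mean_deviates /= sample_meanE.
apply=> //; first by move=> q; rewrite -expectation_def.
(* Independence is given for families indexed by all pairs (arm, time): [B] is carried along [time]
   and extended by [setT]. *)
move=> B mB; pose E (i : 'I_K * nat) := S n i.1 i.2 @^-1`
  (if [pick q | time q == i.2] is Some q then B q else setT).
have EB q : E (j, time q) = S n j (time q) @^-1` B q.
  rewrite /E /=; case: pickP => [p /eqP/timeI ->|/(_ q)] //.
  by rewrite eqxx.
have := indep n [seq (j, time q) | q <- index_enum 'I_Ts] E.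
rewrite !big_map (eq_bigr _ (fun q _ => EB q)).
rewrite [in RHS in _ -> _ -> _ = RHS](eq_bigr (fun q => P (S n j (time q) @^-1` B q)))
  => [|q _]; last by rewrite EB.
apply; first by rewrite map_inj_uniq ?index_enum_uniq // => p q [/timeI].
move=> i; rewrite /E; case: pickP => [q _|_].
  by exists (B q) => //; rewrite setTI.
by exists setT => //; rewrite setTI.
Qed.

Context (Tr : nat).

(** Round [Tr] is included because its draw is the default in [hopping_arm u Tr]. *)
Definition draw_vector (w : T) : {ffun 'I_N * 'I_Tr.+1 -> 'I_K} :=
  [ffun x : 'I_N * 'I_Tr.+1 => U x.1 x.2 w].

Let sigma_rewards : set (set T) :=
  <<s \bigcup_(j in [set: 'I_N * 'I_K * nat]) events_of (S j.1.1 j.1.2 j.2) >>.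

Lemma measurable_draw_vector v : measurable [set w | draw_vector w = v].
Proof.
have [mU _ _] := hU.
have -> : [set w | draw_vector w = v] = [set w | forall x : 'I_N * 'I_Tr.+1, U x.1 x.2 w = v x].
  apply/seteqP; split=> w /=; first by move=> <- x; rewrite ffunE.
  by move=> e; apply/ffunP => x; rewrite ffunE.
by apply: (measurable_forall (A := fun x : 'I_N * 'I_Tr.+1 => [set w | U x.1 x.2 w = v x])) => x.
Qed.

Lemma prob_draw_vector v (D : set T) : measurable D -> sigma_rewards D ->
  fine (P (D `&` [set w | draw_vector w = v])) = fine (P D) / K%:R ^+ (N * Tr.+1).
Proof.
move=> mD sD; have [_ PU indep] := hU.
(* The reward event sits at index [None]; [inord] is exact on the rounds listed in [J]. *)
pose E (i : option ('I_N * nat)) := if i is Some x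
  then [set w | U x.1 x.2 w = v (x.1, inord x.2)] else D.
pose J := None :: [seq Some (x.1, nat_of_ord x.2) | x <- index_enum ('I_N * 'I_Tr.+1)%type].
have uJ : uniq J.
  rewrite /J cons_uniq map_inj_uniq ?index_enum_uniq ?andbT.
    by apply/mapP => -[].
  by move=> [a b] [a' b'] [-> /val_inj ->].
have := indep J E uJ; rewrite /J !big_cons !big_map.
have -> : \big[setI/setT]_(x <- index_enum ('I_N * 'I_Tr.+1)%type)
    E (Some (x.1, nat_of_ord x.2)) = [set w | draw_vector w = v].
  apply/seteqP; split=> w.
    move=> /in_bigsetI h; apply/ffunP => -[n t]; rewrite ffunE /=.
    by have := h (n, t) (mem_index_enum _); rewrite /E /= inord_val.
  move=> /= <-; apply/in_bigsetI => -[n t] _.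
  by rewrite /E /= ffunE /= inord_val.
rewrite (eq_bigr (fun=> (K%:R^-1)%:E)) => [|x _]; last exact: PU.
rewrite -(big_morph EFin (@EFinM R) erefl) prodr_const.
rewrite [E None]/= => ->; last first.
  case=> [[n t]|] //; exists [set v (n, inord t)] => //.
by rewrite fineP // -EFinM /= exprVn card_prod !card_ord.
Qed.

(* Conditioning on the draws, of which the event [D v] is independent. *)
Lemma fine_prob_le_draws (D : {ffun 'I_N * 'I_Tr.+1 -> 'I_K} -> set T)
    (A : set T) (c : {ffun 'I_N * 'I_Tr.+1 -> 'I_K} -> R) :
  (forall v, measurable (D v)) -> (forall v, sigma_rewards (D v)) ->
  measurable A -> (forall w, A w -> D (draw_vector w) w) ->
  (forall v, fine (P (D v)) <= c v) ->
  fine (P A) <= (\sum_v c v) / K%:R ^+ (N * Tr.+1).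
Proof.
move=> mD sD mA AD Dc.
have h := @fine_prob_le_union _ _ _ P _ (fun v => D v `&` [set w | draw_vector w = v]) A.
apply: le_trans (h _ mA _) _.
- by move=> v; apply: measurableI => //; apply: measurable_draw_vector.
- by move=> w Aw; exists (draw_vector w); split=> //; apply: AD.
rewrite mulr_suml; apply: ler_sum => v _.
by rewrite prob_draw_vector // ler_wpM2r // invr_ge0 exprn_ge0.
Qed.

(** The sample space with the rewards' sigma-algebra as its measurable structure. *)
Let R' := g_sigma_algebraType
  (\bigcup_(j in [set: 'I_N * 'I_K * nat]) events_of (S j.1.1 j.1.2 j.2)).

Lemma sigma_rewards_deviates (Ts : nat) (tau : R) n (k j : 'I_K) :
  sigma_rewards (mean_deviates Ts Tr tau (mu n j) (S n j) k j).
Proof.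
apply: (@measurable_mean_deviates _ R' _ _ _ _ _ _ (fun t => S n j t : R' -> R)) => t.
move=> _ B mB; rewrite setTI; apply: sub_sigma_algebra.
by exists (n, j, t) => //; exists B => //; rewrite setTI.
Qed.

Lemma measurable_draws (Q : set {ffun 'I_N * 'I_Tr.+1 -> 'I_K}) :
  measurable [set w | Q (draw_vector w)].
Proof.
apply: (measurable_fibers (f := draw_vector)) => v.
have [Qv|nQv] := pselect (Q v).
  rewrite (_ : _ `&` _ = [set w | draw_vector w = v]); first exact: measurable_draw_vector.
  by apply/seteqP; split=> w /=; [case|move=> ->].
rewrite (_ : _ `&` _ = set0) //.
by apply/seteqP; split=> w //= [Qw e]; apply: nQv; rewrite -e.
Qed.

Lemma hop_state_draws w t n : (t <= Tr)%N ->
  hop_state (fun n t => U n t w) t n = hop_state (draws_of (draw_vector w)) t n.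
Proof.
move=> tTr; apply: eq_hop_state => m i it.
by rewrite /draws_of ffunE /= inordK // ltnS (leq_trans (ltnW it)).
Qed.

Lemma hopping_arm_draws w n :
  hopping_arm (fun n t => U n t w) Tr n = hopping_arm (draws_of (draw_vector w)) Tr n.
Proof.
by rewrite /hopping_arm hop_state_draws // /draws_of ffunE /= inordK.
Qed.

Lemma measurable_unsettled n :
  measurable [set w | ~~ hop_state (fun n t => U n t w) Tr n].
Proof.
have -> : [set w | ~~ hop_state (fun n t => U n t w) Tr n] =
    [set w | ~~ hop_state (draws_of (draw_vector w)) Tr n].
  by apply/seteqP; split=> w /=; rewrite hop_state_draws.
exact: (measurable_draws [set v | ~~ hop_state (draws_of v) Tr n]).
Qed.

Lemma measurable_estimate_deviates (Ts : nat) (tau : R) n (j : 'I_K) :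
  measurable [set w | mean_deviates Ts Tr tau (mu n j) (S n j)
                        (hopping_arm (fun n t => U n t w) Tr n) j w].
Proof.
apply: (measurable_fibers (f := draw_vector)) => v.
rewrite (_ : _ `&` _ = mean_deviates Ts Tr tau (mu n j) (S n j)
    (hopping_arm (draws_of v) Tr n) j `&` [set w | draw_vector w = v]).
  by apply: measurableI; [apply: measurable_mean_deviates | apply: measurable_draw_vector].
by apply/seteqP; split=> w /= [h e]; split=> //; move: h; rewrite hopping_arm_draws e.
Qed.

(** The draws decide who is settled, so the conditional event is everything or nothing and the
    average is a count. *)
Lemma prob_unsettled n : (0 < N <= K)%N ->
  fine (P [set w | ~~ hop_state (fun n t => U n t w) Tr n]) <= (K.-1%:R / K%:R) ^+ Tr.
Proof.
move=> /andP[N0 NK]; have K0 : 0 < K%:R :> R by rewrite ltr0n (leq_trans N0).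
pose B := [pred v : {ffun 'I_N * 'I_Tr.+1 -> 'I_K} | ~~ hop_state (draws_of v) Tr n].
apply: le_trans (@fine_prob_le_draws (fun v => if B v then setT else set0) _
  (fun v => (B v)%:R) _ _ _ _ _) _.
- by move=> v; case: ifP.
- by move=> v; case: ifP => _; [apply: (@measurableT _ R') | apply: (@measurable0 _ R')].
- exact: measurable_unsettled.
- by move=> w /=; rewrite /B /= hop_state_draws // => ->.
- move=> v; case: (B v); last by rewrite measure0.
  by rewrite probability_setT.
rewrite -natr_sum ler_pdivrMr ?exprn_gt0 // exprMn exprVn mulrAC.
rewrite ler_pdivlMr ?exprn_gt0 // -!natrX -!natrM ler_nat mulnC.
rewrite (_ : (\sum_v B v)%N = #|B|); first exact: card_unsettled.
by rewrite -sum1_card [RHS]big_mkcond /=; apply: eq_bigr => v _; rewrite unfold_in; case: (B v).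
Qed.

(** Given the draws the starting arm is fixed, and the bound is the same for all draw vectors. *)
Lemma prob_estimate_deviates (Ts : nat) (tau : R) n (j : 'I_K) :
  (0 < K)%N -> (0 < Ts)%N -> 0 <= tau ->
  fine (P [set w | mean_deviates Ts Tr tau (mu n j) (S n j)
                     (hopping_arm (fun n t => U n t w) Tr n) j w]) <=
  2 * expR (- (2 * Ts%:R * tau ^+ 2)).
Proof.
move=> K0 Ts0 tau0.
apply: le_trans (@fine_prob_le_draws (fun v => mean_deviates Ts Tr tau (mu n j) (S n j)
  (hopping_arm (draws_of v) Tr n) j) _ (fun=> 2 * expR (- (2 * Ts%:R * tau ^+ 2))) _ _ _ _ _) _.
- by move=> v; apply: measurable_mean_deviates.
- by move=> v; apply: sigma_rewards_deviates.
- exact: measurable_estimate_deviates.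
- by move=> w /=; rewrite hopping_arm_draws.
- by move=> v; apply: prob_mean_deviates.
rewrite sumr_const card_ffun card_prod !card_ord -[X in X / _]mulr_natr natrX mulfK //.
by rewrite expf_neq0 // pnatr_eq0 gtn_eqF.
Qed.

End Probabilities.

Unset Implicit Arguments.
Set Strict Implicit.
Set Printing Implicit Defensive.

Theorem theorem2 (R : realType) (d : measure_display) (T : measurableType d)
    (P : probability T R) (N K : nat) (hN : (1 <= N)%N) (hNK : (N <= K)%N)
    (mu : 'M[R]_(N, K))
    (S : 'I_N -> 'I_K -> nat -> {RV P >-> R}) (hS : reward_process S mu)
    (U : 'I_N -> nat -> T -> 'I_K) (hU : private_draws S U)
    (assign : forall n : nat, 'M[R]_(n, K) -> 'I_n -> 'I_K)
    (hassign : forall (n : nat) (M : 'M[R]_(n, K)), (n <= K)%N ->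
       optimal_assignment M (assign n M))
    (eps delta : R) (heps : 0 < eps) (hdelta : 0 < delta < 1) :
  let Tr := hopping_rounds K delta in
  let Ts := samples_per_arm N K eps delta in
  let Tb := packet_length N eps in
  eps_delta_optimal P mu
    (fun w => selected_arm (fun=> doa Ts Tr Tb assign)
       (fun n t => U n t w) (fun t n k => S n k t w))
    eps delta (Tr + K + K * Ts + N * K * Tb).
Proof.
move=> Tr Ts Tb t tT pistar [pistar_inj _].
have K0 : (0 < K)%N by apply: leq_trans hNK.
have N0' : 0 < N%:R :> R by rewrite ltr0n.
have K0' : 0 < K%:R :> R by rewrite ltr0n.
have NK' : N%:R <= K%:R :> R by rewrite ler_nat.
have [d0 d1] := andP hdelta.
set A := [set w | _].
have [mU _ _] := hU.
have mS n k t' : measurable_fun setT (S n k t') by exact: measurable_funPT.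
have mA : measurable A.
  exact: (measurable_selected Ts Tr Tb assign (S := fun n k t' => S n k t' : T -> R) mU mS t
    [set a | (\sum_n mu n (pistar n) - eps <= \sum_n mu n (a n))%R]).
(* The tolerance for estimation and for truncation alike, so that [N * (4 tau) = eps]. *)
pose tau := eps / (4 * N%:R).
have tau0 : 0 <= tau by rewrite divr_ge0 // ?ltW // mulr_gt0.
have Ts0 : (0 < Ts)%N by apply: samples_per_arm_gt0.
pose C (i : 'I_N + 'I_N * 'I_K) := match i with
  | inl n => [set w | ~~ hop_state (fun n t => U n t w) Tr n]
  | inr (n, j) => [set w | mean_deviates Ts Tr tau (mu n j) (S n j)
                     (hopping_arm (fun n t => U n t w) Tr n) j w]
  end.
have mC i : measurable (C i).
  case: i => [n|[n j]]; first exact: (measurable_unsettled hU).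
  exact: (measurable_estimate_deviates mu hU).
have AC w : (~` A) w -> exists i, C i w.
  move=> nA; apply: contrapT => nC; apply: nA; rewrite /A /=.
  have -> : eps = N%:R * (4 * tau) by rewrite /tau; field; rewrite gt_eqF.
  apply: doa_near_optimal => //.
  - by move=> M; apply: hassign.
  - by move=> t' n k; have [S01 _ _ _] := hS; apply: S01.
  - exact: packet_length_le.
  - by move=> n; apply/negPn/negP => h; apply: nC; exists (inl n).
  - move=> n j; rewrite leNgt; apply/negP => h; apply: nC.
    by exists (inr (n, j)).
suff : fine (P (~` A)) <= delta.
  rewrite probability_setC // fineP // -EFinB /= => h.
  by rewrite lee_fin; lra.
apply: le_trans (fine_prob_le_union P mC (measurableC mA) AC) _.
rewrite big_sumType /=.
have -> : delta = delta / 2 + delta / 2 by field.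
apply: lerD.
  (* [N] players at [delta / (2 K)] each cost at most [delta / 2], since [N <= K]. *)
  apply: (@le_trans _ _ (\sum_(n < N) delta / (2 * K%:R))).
    apply: ler_sum => n _; apply: le_trans (hopping_rounds_le K0 hdelta).
    by apply: (prob_unsettled hU); rewrite hN.
  rewrite sumr_const card_ord -[leLHS]mulr_natr mulrAC ler_pdivrMr ?mulr_gt0 //.
  have -> : delta / 2 * (2 * K%:R) = delta * K%:R by field.
  by rewrite ler_wpM2l // ltW.
apply: (@le_trans _ _ (\sum_(i : 'I_N * 'I_K) delta / (2 * N%:R * K%:R))).
  apply: ler_sum => -[n j] _; apply: le_trans (samples_per_arm_le hN K0 heps d0).
  exact: (prob_estimate_deviates hS hU).
rewrite sumr_const card_prod !card_ord -[leLHS]mulr_natr natrM.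
by rewrite le_eqVlt; apply/orP; left; apply/eqP; field; rewrite !gt_eqF.
Qed.
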